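(* Let $G$ be a (finite, simple) plane graph with minimum degree five. Then $G$ contains at least one of the following minor $5$-stars: $\langle 5,5,5,7,17\rangle$, $\langle 7,5,5,7,11\rangle$, $\langle 7,5,5,8,9\rangle$, $\langle 7,5,5,9,8\rangle$, $\langle 7,5,5,11,7\rangle$, $\langle 5,5,5,8,11\rangle$, $\langle 8,5,5,9,7\rangle$, $\langle 8,5,5,11,6\rangle$, $\langle 6,6,6,6,11\rangle$, $\langle 6,6,6,7,9\rangle$, $\langle 6,6,7,6,9\rangle$, $\langle 6,6,7,7,7\rangle$, $\langle 6,7,6,7,7\rangle$, $\langle 5,6,6,8,9\rangle$, $\langle 5,6,8,6,9\rangle$, $\langle 5,6,7,7,9\rangle$, $\langle 5,6,6,7,11\rangle$, $\langle 5,6,7,6,11\rangle$, $\langle 5,7,6,7,9\rangle$, $\langle 5,7,7,6,9\rangle$, $\langle 5,6,6,6,17\rangle$, $\langle 5,7,6,6,11\rangle$, $\langle 5,8,6,6,10\rangle$, $\langle 5,9,6,6,9\rangle$, $\langle 5,5,9,6,9\rangle$, $\langle 5,6,6,5,\infty\rangle$, $\langle 5,6,7,5,23\rangle$, $\langle 5,6,8,5,15\rangle$, $\langle 5,6,9,5,14\rangle$, $\langle 5,9,5,6,10\rangle$, $\langle 5,8,5,6,11\rangle$, $\langle 5,7,5,6,17\rangle$, $\langle 5,7,7,5,11\rangle$, $\langle 5,7,8,5,9\rangle$, $\langle 5,8,5,7,9\rangle$, $\langle 5,7,5,7,11\rangle$, $\langle 5,7,5,8,10\rangle$, $\langle 5,7,5,9,9\rangle$,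 $\langle 5,5,10,5,14\rangle$, $\langle 5,5,11,5,13\rangle$.
   Context: A plane graph is a graph embedded in the plane without edge crossings; $\deg(v)$ denotes the degree of $v$ in $G$. For integers (or $\infty$) $\kappa_1,\dots,\kappa_5$, a $\langle \kappa_1,\kappa_2,\kappa_3,\kappa_4,\kappa_5\rangle$-star in $G$ is a vertex $v$ of degree exactly $5$ together with its five neighbors $v_1,\dots,v_5$, listed in the cyclic order around $v$ given by the embedding (starting at some neighbor, in either orientation), such that $\deg(v_i)\le \kappa_i$ for $i=1,\dots,5$; the entry $\infty$ means no restriction. A minor $5$-star is a $5$-vertex together with its five neighbors. *)

(* Defs.v *)
From HB Require Import structures.
From mathcomp Require Import all_boot all_order all_algebra.
From mathcomp Require Import all_classical all_reals all_analysis.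
Set Implicit Arguments.
Unset Strict Implicit.
Unset Printing Implicit Defensive.
Import Order.TTheory GRing.Theory Num.Theory.
Import numFieldNormedType.Exports.
Local Open Scope classical_set_scope.
Local Open Scope ring_scope.

Definition degree (V : finType) (e : rel V) (v : V) : nat := #|[pred w | e v w]|.

Definition min_degree_eq (V : finType) (e : rel V) (d : nat) : Prop :=
  (forall v, (d <= degree e v)%N) /\ (exists v, degree e v = d).

(* A crossing-free embedding in the plane of the graph with vertex type V and
   adjacency relation e.  The edge uv is the Jordan arc parametrised on [0, 1]
   by [arc u v], from u to v; [arc v u] is the same arc run backwards.  The
   values of [arc u v] for non-adjacent u, v, and outside [0, 1], are
   irrelevant. *)
Record plane_embedding (R : realType) (V : finType) (e : rel V) := PlaneEmbedding {
  point : V -> R * R ;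
  arc : V -> V -> R -> R * R ;
  point_inj : injective point ;
  arc_continuous : forall u v, e u v ->
    {within `[0, 1], continuous (arc u v)} ;
  arc_inj : forall u v, e u v -> {in `[0, 1] &, injective (arc u v)} ;
  arc_source : forall u v, e u v -> arc u v 0 = point u ;
  arc_target : forall u v, e u v -> arc u v 1 = point v ;
  arc_reverse : forall u v, e u v ->
    {in `[0, 1], forall t, arc v u t = arc u v (1 - t)} ;
  arc_avoids_points : forall u v w, e u v ->
    {in `]0, 1[, forall t, arc u v t <> point w} ;
  arc_no_crossing : forall u v x y, e u v -> e x y ->
    (x, y) <> (u, v) -> (x, y) <> (v, u) ->
    {in `]0, 1[ &, forall s t, arc u v s <> arc x y t}
}.

Definition sqdist (R : realType) (p q : R * R) : R :=
  (p.1 - q.1) ^+ 2 + (p.2 - q.2) ^+ 2.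

(* p is the point where the curve gamma, starting at c, first meets the
   Euclidean circle of radius r centred at c. *)
Definition first_hit (R : realType) (c : R * R) (r : R) (gamma : R -> R * R)
    (p : R * R) : Prop :=
  exists t : R, [/\ t \in `[0, 1], gamma t = p, sqdist p c = r ^+ 2 &
    {in `[0, t[, forall s, sqdist (gamma s) c < r ^+ 2}].

(* Twice the signed area of the triangle pqr.  For three points of one circle
   it is positive exactly when they are distinct and occur in the
   counterclockwise order p, q, r. *)
Definition orient (R : realType) (p q r : R * R) : R :=
  (q.1 - p.1) * (r.2 - p.2) - (q.2 - p.2) * (r.1 - p.1).

(* The edges from v to w 0, ..., w (n - 1) leave v in this counterclockwise
   cyclic order: on every small enough circle around v, the points where these
   edges first meet the circle occur in this order, that is, every three of
   them do.  (For pairwise disjoint arcs the order does not depend on the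
   radius.) *)
Definition ccw_around (R : realType) (V : finType) (e : rel V)
    (G : plane_embedding R e) (v : V) (n : nat) (w : 'I_n -> V) : Prop :=
  \forall r \near (0 : R)^'+, exists p : 'I_n -> R * R,
    (forall i, first_hit (point G v) r (arc G v (w i)) (p i)) /\
    (forall i j k : 'I_n, (i < j < k)%N -> 0 < orient (p i) (p j) (p k)).

(* In either orientation. *)
Definition cyclic_order_around (R : realType) (V : finType) (e : rel V)
    (G : plane_embedding R e) (v : V) (n : nat) (w : 'I_n -> V) : Prop :=
  ccw_around G v w \/ ccw_around G v (w \o @rev_ord n).

(* [None] stands for infinity. *)
Definition bounded_by (d : nat) (kappa : option nat) : Prop :=
  if kappa is Some k then (d <= k)%N : Prop else True.

Definition has_star (R : realType) (V : finType) (e : rel V)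
    (G : plane_embedding R e) (kappa : 5.-tuple (option nat)) : Prop :=
  exists (v : V) (w : 'I_5 -> V),
    [/\ degree e v = 5%N,
        injective w,
        forall i, e v (w i),
        cyclic_order_around G v w &
        forall i, bounded_by (degree e (w i)) (tnth kappa i)].

Definition star_of (a b c d f : option nat) : 5.-tuple (option nat) :=
  [tuple a; b; c; d; f].

Definition star (a b c d f : nat) : 5.-tuple (option nat) :=
  star_of (Some a) (Some b) (Some c) (Some d) (Some f).

(* Main.v *)
(* For disjoint arcs [g], [d] the argument of [g s - d t] lifts continuously to
   the unit square, and for two arcs leaving the same point it lifts outside the
   corner [(0, 0)]; comparing the lifts near that corner shows that the cyclic
   order of the first hits on small circles does not depend on the radius, and
   yields a rotation system.  Integrating the same arguments against a
   circulation on the edges gives a winding number on the two sides of every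
   dart, which is constant along faces and jumps by the flow across an edge.
   Hence every circulation is a coboundary of faces, and E - V < F.

   Discharging: a vertex has charge [deg - 6], and a face of length [k] has
   charge [2 (k - 3)], of which each corner of a non-triangular face receives
   1/2.  A vertex of degree d >= 8 gives (about) 1 - 6/d through each of its
   corners, to the 5-vertices next to it on that face; a 7-vertex gives 1/4 to
   every 5-neighbour that is not flanked by two 5-neighbours.  In the remaining
   deficient stars, (5, 5, u, 5, z) with (u = 7, z >= 24), (u = 8, 16 <= z <= 23)
   or (u = 9, 15 <= z <= 17), the centre takes 1/4, 1/8 or 1/15 from one of the
   two adjacent 5-neighbours a, b: from b (the one next to u) if the third
   vertex of the triangle beyond ab has degree < 12, and from a otherwise.
   The charges only depend on the degrees rounded down to the thresholds 5, ...,
   12, 14, 15, 16, 18, 24, so the check at a 5-vertex is finite; there they are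
   integers after multiplication by 18480. *)

Require Import Defs.
From Stdlib Require Import ZArith.
From mathcomp Require Import all_boot all_order all_fingroup all_algebra.
From mathcomp Require Import all_classical all_reals all_analysis.
From mathcomp Require Import ring lra zify ssrZ.
Set Implicit Arguments.
Unset Strict Implicit.
Unset Printing Implicit Defensive.
Import Order.TTheory GRing.Theory Num.Theory.
Import numFieldNormedType.Exports.

(** * Arguments along plane paths *)

Section Arguments.
Local Open Scope classical_set_scope.
Local Open Scope ring_scope.
Variable R : realType.
Implicit Types (p q u w : R * R) (a b t : R).

Definition arg_of p a := exists2 k : R, 0 < k & p = (k * cos a, k * sin a).

Definition dotp u w : R := u.1 * w.1 + u.2 * w.2.
Definition crossp u w : R := u.1 * w.2 - u.2 * w.1.

(** As long as the angle from [u] to [w] is acute, it is this arctangent; the explicit formula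
    follows a moving vector continuously, without a choice of branch. *)
Lemma arg_step u w a : arg_of u a -> 0 < dotp u w ->
  arg_of w (a + atan (crossp u w / dotp u w)).
Proof.
case=> k k0 -> {u}; case: w => x y; rewrite /dotp /crossp /=.
set D := (X in 0 < X); set C := (X in atan (X / _)) => D0.
set z := atan (C / D).
have cz : 0 < cos z by apply: cos_gt0_pihalf; rewrite atan_gtNpi2 atan_ltpi2.
have tz : sin z / cos z = C / D by rewrite -/(tan z) atanK.
have sz : sin z = C / D * cos z by rewrite -tz mulfVK // gt_eqF.
have ca : cos a ^+ 2 + sin a ^+ 2 = 1 by apply: cos2Dsin2.
have Dn : D != 0 by rewrite gt_eqF.
exists (D / (k * cos z)); first by rewrite divr_gt0 // mulr_gt0.
have kn : k != 0 by rewrite gt_eqF.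
have cn : cos z != 0 by rewrite gt_eqF.
rewrite cosD sinD sz; congr pair.
- have -> : D / (k * cos z) * (cos a * cos z - sin a * (C / D * cos z)) =
     (D * cos a - sin a * C) / k by field; rewrite kn cn Dn.
  rewrite /D /C.
  have -> : (k * cos a * x + k * sin a * y) * cos a -
     sin a * (k * cos a * y - k * sin a * x) = k * (x * (cos a ^+2 + sin a ^+ 2)).
    by ring.
  by rewrite ca mulr1 mulrAC divff // mul1r.
- have -> : D / (k * cos z) * (sin a * cos z + cos a * (C / D * cos z)) =
     (D * sin a + cos a * C) / k by field; rewrite kn cn Dn.
  rewrite /D /C.
  have -> : (k * cos a * x + k * sin a * y) * sin a +
     cos a * (k * cos a * y - k * sin a * x) = k * (y * (cos a ^+2 + sin a ^+ 2)).
    by ring.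
  by rewrite ca mulr1 mulrAC divff // mul1r.
Qed.

Lemma dotpp_gt0 u : u <> 0 -> 0 < dotp u u.
Proof.
case: u => x y n; rewrite /dotp /= -!expr2 lt_neqAle eq_sym addr_ge0 ?sqr_ge0 // andbT.
apply/negP => /eqP h; apply: n.
have := sqr_ge0 x; have := sqr_ge0 y => h1 h2.
have/eqP : x ^+ 2 = 0 by lra.
have/eqP : y ^+ 2 = 0 by lra.
by rewrite !sqrf_eq0 => /eqP -> /eqP ->.
Qed.

Lemma arg_exists p : p <> 0 -> exists a, arg_of p a.
Proof.
(* Every nonzero vector has a positive product with one of the four unit vectors on the axes, whose
   arguments are known. *)
move=> p0; have e q a : (q.1 = cos a) -> (q.2 = sin a) -> 0 < dotp q p ->
    exists a, arg_of p a.
  move=> q1 q2 d; exists (a + atan (crossp q p / dotp q p)).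
  by apply: arg_step => //; exists 1 => //; rewrite !mul1r -q1 -q2; case: q {q1 q2 d}.
case: p p0 e => x y p0 e; rewrite /dotp /= in e.
have [x0|x0|x0] := ltgtP x 0.
- by apply: (e (-1, 0) pi); rewrite ?cospi ?sinpi //=; lra.
- by apply: (e (1, 0) 0); rewrite ?cos0 ?sin0 //=; lra.
- have [y0|y0|y0] := ltgtP y 0.
  + by apply: (e (0, -1) (- (pi / 2))); rewrite ?cosN ?sinN ?cos_pihalf ?sin_pihalf //=; lra.
  + by apply: (e (0, 1) (pi / 2)); rewrite ?cos_pihalf ?sin_pihalf //=; lra.
  + by case: p0; rewrite x0 y0.
Qed.

Lemma arg_neq0 p a : arg_of p a -> p <> 0.
Proof.
case=> k k0 -> [] /eqP + /eqP; rewrite !mulf_eq0 gt_eqF //= => /eqP ca /eqP sa.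
have := cos2Dsin2 a; rewrite ca sa !expr2 !mul0r addr0 => /eqP.
by rewrite eq_sym oner_eq0.
Qed.

Lemma arg_opp p a : arg_of p a -> arg_of (- p) (a + pi).
Proof.
case=> k k0 ->; exists k => //.
by rewrite cosDpi sinDpi !mulrN.
Qed.

Lemma cosD2kpi a (k : int) : cos (a + (pi *+ 2) *~ k) = cos a.
Proof.
case: k => n; first by rewrite -pmulrn; exact: (periodicn (@cosD2pi R)).
rewrite NegzE -[in RHS](subrK (pi *+ 2 *+ n.+1) a).
by rewrite (periodicn (@cosD2pi R)) mulrNz -pmulrn.
Qed.

Lemma sinD2kpi a (k : int) : sin (a + (pi *+ 2) *~ k) = sin a.
Proof.
case: k => n; first by rewrite -pmulrn; exact: (periodicn (@sinD2pi R)).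
rewrite NegzE -[in RHS](subrK (pi *+ 2 *+ n.+1) a).
by rewrite (periodicn (@sinD2pi R)) mulrNz -pmulrn.
Qed.

Lemma arg_ofD2kpi p a (k : int) : arg_of p a -> arg_of p (a + (pi *+ 2) *~ k).
Proof. by case=> c c0 ->; exists c => //; rewrite cosD2kpi sinD2kpi. Qed.

Lemma arg_cosB u w a b : arg_of u a -> arg_of w b -> 0 < dotp u w ->
  0 < cos (b - a).
Proof.
case=> k k0 -> [l l0 ->]; rewrite /dotp /= cosB.
have -> : k * cos a * (l * cos b) + k * sin a * (l * sin b) =
  (k * l) * (cos b * cos a + sin b * sin a) by ring.
by rewrite pmulr_rgt0 // mulr_gt0.
Qed.

Lemma arg_sinB p a b : arg_of p a -> arg_of p b -> sin (b - a) = 0.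
Proof.
case=> k k0 -> [l l0 [e1 e2]].
have : (k * l) * sin (b - a) = 0.
  rewrite sinB.
  have -> : k * l * (sin b * cos a - cos b * sin a) =
   (k * cos a) * (l * sin b) - (l * cos b) * (k * sin a) by ring.
  by rewrite -e1 -e2 mulrC subrr.
by move/eqP; rewrite mulf_eq0 gt_eqF /= ?mulr_gt0 // => /eqP.
Qed.

Lemma floor2pi (x : R) : exists k : int, 0 <= x - (pi *+ 2) *~ k < pi *+ 2.
Proof.
have p2 : 0 < (pi : R) *+ 2 by rewrite pmulrn_rgt0 // pi_gt0.
exists (Num.floor (x / (pi *+ 2))).
have /andP[] := floor_itv (x / (pi *+ 2)).
set k := Num.floor _.
rewrite ler_pdivlMr // ltr_pdivrMr // intrD mulrDl mul1r mulrzl => h1 h2.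
by rewrite subr_ge0 h1 ltrBlDr addrC.
Qed.

(** Reduced modulo full turns, the difference of the two arguments lies in [0, 2 pi), has sine 0 and
    positive cosine, so it vanishes. *)
Lemma arg_mod p a b : arg_of p a -> arg_of p b ->
  exists k : int, b = a + (pi *+ 2) *~ k.
Proof.
move=> pa pb; have [k /andP[h1 h2]] := floor2pi (b - a).
exists k; set d := _ - _ in h1 h2.
have pc : arg_of p (a + d).
  have := arg_ofD2kpi (- k) pb.
  by rewrite mulrNz (_ : b - _ = a + d) // /d; ring.
have p0 : 0 < (pi : R) by exact: pi_gt0.
have sd : sin d = 0 by rewrite -(arg_sinB pa pc); congr sin; ring.
have cd : 0 < cos d.
  have := arg_cosB pa pc (dotpp_gt0 (arg_neq0 pa)); congr (0 < cos _); ring.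
suff d0 : d = 0 by move: d0; rewrite /d; lra.
have [dn|dn|//] := ltgtP d 0; first by move: h1; rewrite leNgt dn.
have [dp|dp|dp] := ltgtP d pi.
- by have := @sin_gt0_pi _ d; rewrite dn dp sd ltxx => /(_ isT).
- have : sin (d - pi) = 0.
    by have := sinDpi (d - pi); rewrite subrK sd => /eqP; rewrite eq_sym oppr_eq0 => /eqP.
  have := @sin_gt0_pi _ (d - pi).
  have -> : 0 < d - pi < pi by move: h2; rewrite mulr2n; lra.
  by move=> /(_ isT) + s0; rewrite s0 ltxx.
- by move: cd; rewrite dp cospi; lra.
Qed.

End Arguments.

(** * Continuous arguments along a path, as sums of small turns *)

Section Lifts.
Local Open Scope classical_set_scope.
Local Open Scope ring_scope.
Variable R : realType.
Implicit Types (p q g d : R -> R * R) (a b s t : R) (u w : R * R).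

Definition cpath p := continuous (fun t => (p t).1) /\ continuous (fun t => (p t).2).

(** Composing with this retraction of the line onto [a, b] turns continuity on an interval into
    continuity everywhere. *)
Definition clamp a b t : R := Num.max a (Num.min b t).

Lemma clamp_itv a b t : a <= b -> a <= clamp a b t <= b.
Proof.
move=> ab; rewrite /clamp le_max lexx /= ge_max ab /= ge_min lexx //.
Qed.

Lemma clamp_id a b t : a <= t <= b -> clamp a b t = t.
Proof. by case/andP=> at_ tb; rewrite /clamp min_r // max_r. Qed.

Lemma clamp_l a b t : a <= b -> t <= a -> clamp a b t = a.
Proof. by move=> ab ta; rewrite /clamp max_l // ge_min ta orbT. Qed.

Lemma clamp_r a b t : a <= b -> b <= t -> clamp a b t = b.
Proof. by move=> ab bt; rewrite /clamp min_l // max_r. Qed.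

Lemma clamp_lip a b s t : a <= b -> `|clamp a b s - clamp a b t| <= `|s - t|.
Proof.
move=> ab; wlog st : s t / s <= t => [hw|].
  have [st|ts] := leP s t; first exact: hw.
  by rewrite distrC [leRHS]distrC hw // ltW.
rewrite distrC [leRHS]distrC (ger0_norm (_ : 0 <= t - s)) ?subr_ge0 //.
have [sa|sa] := leP s a; have [ta|ta] := leP t a;
have [sb|sb] := leP s b; have [tb|tb] := leP t b;
rewrite ?(clamp_l ab sa) ?(clamp_l ab ta) ?(clamp_r ab (ltW sb)) ?(clamp_r ab (ltW tb));
rewrite ?(@clamp_id _ _ s) ?(@clamp_id _ _ t) ?sb ?tb ?(ltW sa) ?(ltW ta) //; rewrite ger0_norm; lra.
Qed.

Lemma clamp_continuous a b : a <= b -> continuous (clamp a b).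
Proof.
move=> ab x; apply/cvgrPdist_lt => e e0; apply/nbhs_ballP; exists e => //= y xy.
exact: le_lt_trans (clamp_lip x y ab) xy.
Qed.

Lemma cpath_comp p (h : R -> R) : cpath p -> continuous h -> cpath (p \o h).
Proof. by move=> [p1 p2] ch; split=> t; [exact: (continuous_comp (ch t) (p1 (h t)))|exact: (continuous_comp (ch t) (p2 (h t)))]. Qed.

Lemma cpathB p q : cpath p -> cpath q -> cpath (fun t => p t - q t).
Proof. by move=> [p1 p2] [q1 q2]; split=> t; [exact: (continuousB (p1 t) (q1 t))|exact: (continuousB (p2 t) (q2 t))]. Qed.

Lemma cpath_cst u : cpath (fun=> u).
Proof. by split=> t; exact: cvg_cst. Qed.

Definition turnstep u w : R := atan (crossp u w / dotp u w).

Lemma turnstep_continuous p q : cpath p -> cpath q ->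
  (forall t, 0 < dotp (p t) (q t)) -> continuous (fun t => turnstep (p t) (q t)).
Proof.
move=> [p1 p2] [q1 q2] d0 t.
have cc := continuousB (continuousM (p1 t) (q2 t)) (continuousM (p2 t) (q1 t)).
have cd := continuousD (continuousM (p1 t) (q1 t)) (continuousM (p2 t) (q2 t)).
have dn : dotp (p t) (q t) != 0 by rewrite gt_eqF.
have cq : {for t, continuous (fun t => crossp (p t) (q t) / dotp (p t) (q t))}.
  have cc' : {for t, continuous (fun t => crossp (p t) (q t))} by exact: cc.
  have cd' : {for t, continuous (fun t => dotp (p t) (q t))} by exact: cd.
  have cv := @continuousV _ _ (fun t => dotp (p t) (q t)) t dn cd'.
  exact: (continuousM cc' cv).
have := @continuous_comp _ _ _ (fun t => crossp (p t) (q t) / dotp (p t) (q t)) (@atan R) t cq.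
by apply; exact: continuous_atan.
Qed.

Lemma turnstepxx u : turnstep u u = 0.
Proof. by rewrite /turnstep /crossp (mulrC u.1) subrr mul0r atan0. Qed.

Variable n : nat.
Definition node (k : nat) : R := k%:R / n.+1%:R.

Lemma node_le k l : (k <= l)%N -> node k <= node l.
Proof. by move=> kl; rewrite /node ler_pM2r ?invr_gt0 ?ltr0n // ler_nat. Qed.

Lemma nodeS k : node k.+1 - node k = n.+1%:R^-1.
Proof. by rewrite /node -mulrBl -natrB // subSnn mul1r. Qed.

(** Because of [clamp], the [k]-th summand is 0 before its subinterval, follows [p] on it and is
    frozen after it. The lift is thus a plain sum of continuous functions, with no gluing. *)
Definition chain p a0 t :=
  a0 + \sum_(k < n.+1) turnstep (p (node k)) (p (clamp (node k) (node k.+1) t)).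

Lemma chainP p a0 : arg_of (p 0) a0 ->
  (forall k : 'I_n.+1, forall t, node k <= t <= node k.+1 -> 0 < dotp (p (node k)) (p t)) ->
  forall t, 0 <= t <= 1 -> arg_of (p t) (chain p a0 t).
Proof.
move=> pa hd.
have H j : (j <= n.+1)%N -> forall t, 0 <= t <= node j -> arg_of (p t)
  (a0 + \sum_(0 <= k < j) turnstep (p (node k)) (p (clamp (node k) (node k.+1) t))).
  elim: j => [_ t|j IH jn t /andP[t0 tj]].
    by rewrite /node mul0r => t0; rewrite big_geq // addr0 -(le_anti t0).
  rewrite big_nat_recr //= addrA.
  (* Before [node j] the new summand is 0. After it the old summands are frozen at an argument of
     [p (node j)], from which [arg_step] continues. *)
  have [tj'|tj'] := leP t (node j).
    rewrite (clamp_l _ tj') ?node_le // turnstepxx addr0; apply: IH; rewrite ?t0 ?tj' //.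
    exact: ltnW.
  rewrite (clamp_id (t := t)) ?tj ?ltW //; apply: arg_step; last first.
    by have := hd (Ordinal jn) t; apply; rewrite /= tj ltW.
  have := IH (ltnW jn) (node j).
  rewrite lexx /node divr_ge0 // => /(_ isT).
  congr (arg_of _ (_ + _)); apply: eq_big_nat => k /andP[_ kj].
  rewrite !(@clamp_r (node k) (node k.+1)) ?node_le //.
  by apply: le_trans (ltW tj'); exact: node_le.
move=> t t01; rewrite /chain -(big_mkord xpredT (fun k => turnstep (p (node k)) (p (clamp (node k) (node k.+1) t)))).
by apply: H; rewrite // /node divff // pnatr_eq0.
Qed.

Lemma sum_continuous (I : Type) (r : seq I) (F : I -> R -> R) :
  (forall i, continuous (F i)) -> continuous (fun t => \sum_(i <- r) F i t).
Proof.
move=> cF; elim: r => [|i r IH].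
  by under eq_fun do rewrite big_nil; move=> t; exact: cvg_cst.
under eq_fun do rewrite big_cons.
by move=> t; exact: (continuousD (cF i t) (IH t)).
Qed.

End Lifts.

(** * Lifts over the unit square and the total turn of a path *)

Section RectLift.
Local Open Scope classical_set_scope.
Local Open Scope ring_scope.
Variable R : realType.
Implicit Types (p q g d : R -> R * R) (a b s t : R) (u w : R * R).

(** For nearby parameters the product is close to the squared length of a nonzero vector;
    compactness of the square gives one mesh for all points. *)
Lemma dotp_modulus g d : cpath g -> cpath d ->
  (forall s t, 0 <= s <= 1 -> 0 <= t <= 1 -> g s <> d t) ->
  exists n : nat, forall s s' t t', 0 <= s <= 1 -> 0 <= t <= 1 ->
    `|s - s'| <= n.+1%:R^-1 -> `|t - t'| <= n.+1%:R^-1 ->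
    0 < dotp (g s - d t) (g s' - d t').
Proof.
move=> [g1 g2] [d1 d2] gd.
pose G (z : (R * R) * (R * R)) := dotp (g z.1.1 - d z.1.2) (g z.2.1 - d z.2.2).
have cG : continuous G.
  move=> z.
  have c11 : {for z, continuous (fun z : (R * R) * (R * R) => z.1.1)}.
    exact: (@continuous_comp _ _ _ fst fst z (@cvg_fst _ _ _ _ _) (@cvg_fst _ _ _ _ _)).
  have c12 : {for z, continuous (fun z : (R * R) * (R * R) => z.1.2)}.
    exact: (@continuous_comp _ _ _ fst snd z (@cvg_fst _ _ _ _ _) (@cvg_snd _ _ _ _ _)).
  have c21 : {for z, continuous (fun z : (R * R) * (R * R) => z.2.1)}.
    exact: (@continuous_comp _ _ _ snd fst z (@cvg_snd _ _ _ _ _) (@cvg_fst _ _ _ _ _)).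
  have c22 : {for z, continuous (fun z : (R * R) * (R * R) => z.2.2)}.
    exact: (@continuous_comp _ _ _ snd snd z (@cvg_snd _ _ _ _ _) (@cvg_snd _ _ _ _ _)).
  have x1 := continuousB (continuous_comp c11 (g1 _)) (continuous_comp c12 (d1 _)).
  have x2 := continuousB (continuous_comp c11 (g2 _)) (continuous_comp c12 (d2 _)).
  have x3 := continuousB (continuous_comp c21 (g1 _)) (continuous_comp c22 (d1 _)).
  have x4 := continuousB (continuous_comp c21 (g2 _)) (continuous_comp c22 (d2 _)).
  exact: (continuousD (continuousM x1 x3) (continuousM x2 x4)).
pose K := (`[(0 : R), 1] `*` `[(0 : R), 1]) : set (R * R).
have cK : compact K by apply: compact_setX; exact: segment_compact.
pose P (n : nat) (x : R * R) := forall s' t', `|x.1 - s'| <= n.+1%:R^-1 ->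
  `|x.2 - t'| <= n.+1%:R^-1 -> 0 < G (x, (s', t')).
have [] := (compact_near_coveringP K).1 cK nat \oo P _ _.
  move=> x [x1 x2].
  have Gx : 0 < G (x, x).
    rewrite /G /=; apply: dotpp_gt0 => /eqP; rewrite subr_eq0 => /eqP.
    by apply: gd; [move: x1|move: x2]; rewrite /= in_itv.
  have /nbhs_ballP[e /= e0 he] : nbhs (x, x) (fun z => 0 < G z).
    exact: (cG (x, x) _ (lt_nbhsr Gx)).
  exists (ball x (e / 2), [set n | n.+1%:R^-1 < e / 2]) => /=.
    have e20 : 0 < e / 2 by rewrite divr_gt0.
    split; first exact: nbhsx_ballx.
    exact: (near_infty_natSinv_lt (PosNum e20)).
  move=> [y n] /= [[y1 y2] n2] s' t' h1 h2; apply: he.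
  move: y1 y2 h1 h2; rewrite /ball /= => y1 y2 h1 h2.
  have e2 : e / 2 < e by lra.
  split; split; rewrite /ball /=.
  - exact: lt_trans e2.
  - exact: lt_trans e2.
  - apply: le_lt_trans (ler_distD y.1 _ _) _.
    by rewrite [ltRHS](splitr e) ltr_leD // (le_trans h1) // ltW.
  - apply: le_lt_trans (ler_distD y.2 _ _) _.
    by rewrite [ltRHS](splitr e) ltr_leD // (le_trans h2) // ltW.
move=> n _ /(_ n (leqnn n)) H; exists n => s s' t t' hs ht h1 h2.
by apply: (H (s, t)) => //; split; rewrite /= in_itv.
Qed.

Lemma node_in01 n (k : 'I_n.+1) t : node R n k <= t <= node R n k.+1 -> 0 <= t <= 1.
Proof.
case/andP=> h1 h2; apply/andP; split.
  by apply: le_trans h1; rewrite /node divr_ge0.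
apply: le_trans h2 _; rewrite /node ler_pdivrMr ?ltr0n // mul1r ler_nat.
exact: ltn_ord.
Qed.

Lemma node_near n (k : 'I_n.+1) t : node R n k <= t <= node R n k.+1 ->
  `|node R n k - t| <= n.+1%:R^-1.
Proof.
case/andP=> h1 h2; rewrite distrC ger0_norm ?subr_ge0 // -(nodeS R n k).
by rewrite lerB.
Qed.

Lemma node_self n (k : 'I_n.+1) : node R n k <= node R n k <= node R n k.+1.
Proof. by rewrite lexx node_le. Qed.

(** The argument is followed along the bottom side to [(s, 0)] and then up to [(s, t)]. One mesh
    serves all these paths, which also gives continuity in [s]. Continuity in each variable
    separately suffices for turns along the sides. *)
Lemma rect_lift g d : cpath g -> cpath d ->
  (forall s t, 0 <= s <= 1 -> 0 <= t <= 1 -> g s <> d t) ->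
  exists A : R -> R -> R, [/\ forall t, continuous (A^~ t), forall s, continuous (A s)
    & forall s t, 0 <= s <= 1 -> 0 <= t <= 1 -> arg_of (g s - d t) (A s t)].
Proof.
move=> cg cd gd; have [n hn] := dotp_modulus cg cd gd.
have i0 : 0 <= (0 : R) <= 1 by rewrite lexx ler01.
have /arg_exists[a0 ha0] : g 0 - d 0 <> 0.
  by move/eqP; rewrite subr_eq0 => /eqP; apply: gd.
have c01 : (0 : R) <= 1 by exact: ler01.
have cl t : 0 <= clamp 0 1 t <= 1 by exact: clamp_itv.
have ck (k : 'I_n.+1) t : node R n k <= clamp (node R n k) (node R n k.+1) t <= node R n k.+1.
  by apply: clamp_itv; exact: node_le.
pose p0 s := g s - d 0.
pose p s t := g (clamp 0 1 s) - d t.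
have cp0 : cpath p0 by apply: cpathB => //; exact: cpath_cst.
have cp s : cpath (p s) by apply: cpathB => //; exact: cpath_cst.
have nn : 0 <= n.+1%:R^-1 :> R by rewrite invr_ge0.
have cchain q b : cpath q -> (forall (k : 'I_n.+1) t, node R n k <= t <= node R n k.+1 ->
    0 < dotp (q (node R n k)) (q t)) -> continuous (chain n q b).
  move=> cq hq t.
  have cs : continuous (fun t : R => \sum_(k < n.+1) turnstep (q (node R n k))
       (q (clamp (node R n k) (node R n k.+1) t))).
    apply: sum_continuous => k; apply: turnstep_continuous.
    - exact: cpath_cst.
    - apply: (cpath_comp cq); apply: clamp_continuous; exact: node_le.
    - by move=> x; apply: hq; exact: ck.
  exact: (continuousD (@cst_continuous _ _ b t) (cs t)).
have hp0 (k : 'I_n.+1) t : node R n k <= t <= node R n k.+1 ->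
    0 < dotp (p0 (node R n k)) (p0 t).
  move=> kt; apply: hn => //; first exact: node_in01 (node_self k).
    exact: node_near.
  by rewrite subrr normr0.
have hp s (k : 'I_n.+1) t : node R n k <= t <= node R n k.+1 ->
    0 < dotp (p s (node R n k)) (p s t).
  move=> kt; apply: hn => //; first exact: node_in01 (node_self k).
    by rewrite subrr normr0.
  exact: node_near.
have cc0 := cchain _ a0 cp0 hp0.
exists (fun s t => chain n (p s) (chain n p0 a0 (clamp 0 1 s)) t); split.
- move=> t s.
  have cs : continuous (fun s : R => \sum_(k < n.+1) turnstep (p s (node R n k))
       (p s (clamp (node R n k) (node R n k.+1) t))).
    apply: sum_continuous => k; apply: turnstep_continuous.
    - apply: cpathB; last exact: cpath_cst.
      by apply: (cpath_comp cg); exact: clamp_continuous.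
    - apply: cpathB; last exact: cpath_cst.
      by apply: (cpath_comp cg); exact: clamp_continuous.
    - by move=> x; apply: hp; exact: ck.
  exact: (continuousD (continuous_comp (clamp_continuous c01 (x := s)) (cc0 _)) (cs s)).
- by move=> s; apply: cchain; [exact: cp|exact: hp].
- move=> s t hs ht; rewrite -{1}(clamp_id hs).
  apply: (@chainP _ _ (p s)) => //; last exact: hp.
  rewrite /p; apply: (@chainP _ _ p0) => //.
Qed.

(** The difference [D] of the lifts always has sine 0. If it grew, it would take a value [D 0 + e]
    with [e] in (0, pi/2], whose sine is nonzero. *)
Lemma lift_unique p (A B : R -> R) : continuous A -> continuous B ->
  (forall t, 0 <= t <= 1 -> arg_of (p t) (A t)) ->
  (forall t, 0 <= t <= 1 -> arg_of (p t) (B t)) -> A 1 - A 0 = B 1 - B 0.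
Proof.
wlog: A B / A 0 - B 0 <= A 1 - B 1 => [hw cA cB hA hB|].
  have [h|h] := leP (A 0 - B 0) (A 1 - B 1); first exact: hw.
  by symmetry; apply: hw => //; lra.
move=> le cA cB hA hB; apply/eqP/negPn/negP => ne.
set D := fun t => A t - B t.
have cD : continuous D by move=> t; exact: (continuousB (cA t) (cB t)).
have lt : D 0 < D 1.
  by rewrite lt_neqAle le andbT /D; apply: contra ne => /eqP h; apply/eqP; lra.
set e := Num.min (pi / 2) (D 1 - D 0).
have p0 : 0 < (pi : R) by exact: pi_gt0.
have e0 : 0 < e by rewrite lt_min divr_gt0 // subr_gt0.
have e1 : e <= pi / 2 by rewrite ge_min lexx.
have e2 : e <= D 1 - D 0 by rewrite ge_min lexx orbT.
have hm : Num.min (D 0) (D 1) <= D 0 + e <= Num.max (D 0) (D 1).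
  by rewrite (min_l (ltW lt)) (max_r (ltW lt)); apply/andP; split; lra.
have [c c01 Dc] := IVT (@ler01 R) (continuous_subspaceT cD) hm.
rewrite in_itv /= in c01.
have i0 : 0 <= (0 : R) <= 1 by rewrite lexx ler01.
have s0 : sin (D 0) = 0 := arg_sinB (hB _ i0) (hA _ i0).
have : sin (D c) = 0 := arg_sinB (hB _ c01) (hA _ c01).
have c0 : 0 < cos (D 0).
  exact: arg_cosB (hB _ i0) (hA _ i0) (dotpp_gt0 (arg_neq0 (hA _ i0))).
rewrite Dc sinD s0 mul0r add0r => /eqP; rewrite mulf_eq0 gt_eqF //=.
rewrite gt_eqF // sin_gt0_pi // e0 /=; lra.
Qed.

Definition turn_of p (x : R) := exists A : R -> R, [/\ continuous A,
  forall t, 0 <= t <= 1 -> arg_of (p t) (A t) & x = A 1 - A 0].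

(** Well defined by [lift_unique]; a path without a lift, such as one through the origin, gets the
    default 0. *)
Definition turn p := xget 0 [set x | turn_of p x].

Lemma turnE p x : turn_of p x -> turn p = x.
Proof.
rewrite /turn; case: xgetP => [y _ [A [cA hA ->]] [B [cB hB ->]]|h hx].
  exact: lift_unique cA cB hA hB.
by case: (h x).
Qed.

Lemma turn_lift p (A : R -> R) : continuous A ->
  (forall t, 0 <= t <= 1 -> arg_of (p t) (A t)) -> turn p = A 1 - A 0.
Proof. by move=> cA hA; apply: turnE; exists A. Qed.

Lemma turn_lift_from p (A : R -> R) a : 0 <= a <= 1 -> continuous A ->
  (forall t, 0 <= t <= 1 -> arg_of (p t) (A t)) ->
  turn (fun t => p (a + (1 - a) * t)) = A 1 - A a.
Proof.
move=> a01 cA hA.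
have ch : continuous (fun t : R => a + (1 - a) * t).
  move=> t; exact: (continuousD (@cst_continuous _ _ a t) (continuousM (@cst_continuous _ _ (1 - a) t) (@cvg_id _ _))).
rewrite (@turn_lift _ (fun t => A (a + (1 - a) * t))).
- by rewrite mulr1 mulr0 addr0 [a + _]addrC subrK.
- by move=> t; exact: (continuous_comp (ch t) (cA _)).
- by move=> t t01; apply: hA; apply/andP; split; nra.
Qed.

Lemma turn_eq p q : {in `[0, 1], p =1 q} -> turn p = turn q.
Proof.
move=> pq; rewrite /turn; congr xget; apply/funext => x; apply/propext.
by split=> -[A [cA hA ->]]; exists A; split => // t t01; [rewrite -pq|rewrite pq]; rewrite ?in_itv //=; apply: hA.
Qed.

Lemma turn_sub_opp p q : turn (fun t => p t - q t) = turn (fun t => q t - p t).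
Proof.
rewrite /turn; congr xget; apply/funext => x; apply/propext.
have H p' q' : turn_of (fun t => p' t - q' t) x -> turn_of (fun t => q' t - p' t) x.
  move=> [A [cA hA ->]]; exists (fun t => A t + pi); split.
  - by move=> t; exact: (continuousD (cA t) (@cst_continuous _ _ pi t)).
  - by move=> t /hA /arg_opp; rewrite opprB.
  - by ring.
by split; exact: H.
Qed.

Lemma turn_rev p : turn (fun t => p (1 - t)) = - turn p.
Proof.
have ch : continuous (fun t : R => 1 - t).
  move=> t; have cid : {for t, continuous (fun x : R => x)} by exact: cvg_id.
  exact: (continuousB (@cst_continuous R R 1 t) cid).
have H (q : R -> R * R) x : turn_of q x -> turn_of (fun t => q (1 - t)) (- x).
  move=> [A [cA hA ->]]; exists (fun t => A (1 - t)); split.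
  - by move=> t; exact: (continuous_comp (ch t) (cA _)).
  - by move=> t t01; apply: hA; lra.
  - by rewrite subrr subr0 opprB.
rewrite {2}/turn; case: xgetP => [x _ hx|h]; first exact: turnE (H _ _ hx).
(* If [p] has no lift, neither has its reversal, and both sides are the default 0. *)
rewrite oppr0 /turn; case: xgetP => [x _ hx|//].
case: (h (- x)); have := H _ _ hx.
by congr turn_of; apply/funext => t; rewrite subKr.
Qed.

(** The increments of a lift over the square cancel around its boundary. *)
Lemma turn_rect g d : cpath g -> cpath d ->
  (forall s t, 0 <= s <= 1 -> 0 <= t <= 1 -> g s <> d t) ->
  turn (fun s => g s - d 0) + turn (fun t => d t - g 1) =
  turn (fun t => d t - g 0) + turn (fun s => g s - d 1).
Proof.
move=> cg cd gd; have [A [cA1 cA2 hA]] := rect_lift cg cd gd.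
have i0 : 0 <= (0 : R) <= 1 by rewrite lexx ler01.
have i1 : 0 <= (1 : R) <= 1 by rewrite lexx ler01.
rewrite (turn_sub_opp d (fun=> g 1)) (turn_sub_opp d (fun=> g 0)).
have e1 b : 0 <= b <= 1 -> turn (fun s => g s - d b) = A 1 b - A 0 b.
  by move=> b01; apply: (turn_lift (A := A^~ b)) => // t t01; exact: hA.
have e2 a : 0 <= a <= 1 -> turn (fun t => g a - d t) = A a 1 - A a 0.
  by move=> a01; apply: (turn_lift (A := A a)) => // t t01; exact: hA.
by rewrite !e1 // !e2 //; ring.
Qed.

End RectLift.

(** * Two arcs leaving the same point *)

Section Corner.
Local Open Scope classical_set_scope.
Local Open Scope ring_scope.
Variable R : realType.
Implicit Types (p q g d : R -> R * R) (a b s t r : R) (u v w : R * R).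

(** If the lift moved by a quarter turn, [cos (A c - A 0)] would vanish at some [c], against the
    positive product. *)
Lemma half_plane p (A : R -> R) t0 : 0 <= t0 -> continuous A ->
  (forall t, 0 <= t <= t0 -> arg_of (p t) (A t)) ->
  (forall t, 0 <= t <= t0 -> 0 < dotp (p 0) (p t)) ->
  - (pi / 2) < A t0 - A 0 < pi / 2.
Proof.
move=> t0_ge0 cA hA hd.
have i0 : 0 <= (0 : R) <= t0 by rewrite lexx.
have p0 : 0 < (pi : R) / 2 by rewrite divr_gt0 // pi_gt0.
have ncos c : 0 <= c <= t0 -> cos (A c - A 0) != 0.
  by move=> hc; rewrite gt_eqF // (arg_cosB (hA _ i0) (hA _ hc)) // hd.
have cW : {within `[0, t0], continuous A} by exact: continuous_subspaceT.
apply/andP; split; rewrite ltNge; apply/negP => h.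
- have hm : Num.min (A 0) (A t0) <= A 0 - pi / 2 <= Num.max (A 0) (A t0).
    by rewrite ge_min le_max; apply/andP; split; apply/orP; [right|left]; lra.
  have [c] := IVT t0_ge0 cW hm.
  rewrite in_itv /= => /ncos + e; rewrite e.
  by rewrite (_ : _ - _ = - (pi / 2)) ?cosN ?cos_pihalf ?eqxx //; ring.
- have hm : Num.min (A 0) (A t0) <= A 0 + pi / 2 <= Num.max (A 0) (A t0).
    by rewrite ge_min le_max; apply/andP; split; apply/orP; [left|right]; lra.
  have [c] := IVT t0_ge0 cW hm.
  rewrite in_itv /= => /ncos + e; rewrite e.
  by rewrite (_ : _ - _ = pi / 2) ?cos_pihalf ?eqxx //; ring.
Qed.

Lemma sqdistE u v : sqdist u v = dotp (u - v) (u - v).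
Proof. by rewrite /sqdist /dotp !expr2. Qed.

(** Twice the product is [|u - w|^2 + |u|^2 - |w|^2]: a chord into the disc makes an acute angle
    with the radius. *)
Lemma dotp_chord u w : u <> w -> dotp w w <= dotp u u -> 0 < dotp u (u - w).
Proof.
move=> uw ww; have : 0 < dotp (u - w) (u - w).
  by apply: dotpp_gt0 => /eqP; rewrite subr_eq0 => /eqP.
by move: ww; rewrite /dotp /=; lra.
Qed.

Definition first_time g r s := [/\ 0 < s, s <= 1, sqdist (g s) (g 0) = r ^+ 2 &
  forall t, 0 <= t < s -> sqdist (g t) (g 0) < r ^+ 2].

Definition tail g s t := g (s + (1 - s) * t).

Lemma tail0 g s : tail g s 0 = g s.
Proof. by rewrite /tail mulr0 addr0. Qed.

Lemma tail1 g s : tail g s 1 = g 1.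
Proof. by rewrite /tail mulr1 addrC subrK. Qed.

Lemma tail_cpath g s : cpath g -> cpath (tail g s).
Proof.
move=> cg; apply: (cpath_comp cg) => t.
exact: (continuousD (@cst_continuous _ _ s t) (continuousM (@cst_continuous _ _ (1 - s) t) (@cvg_id _ _))).
Qed.

Lemma tail_itv s t : 0 <= s <= 1 -> 0 <= t <= 1 -> s <= s + (1 - s) * t <= 1.
Proof. by move=> hs ht; apply/andP; split; nra. Qed.

(* The argument of g s - g 0 obtained by unwinding g backwards from its end. *)
Definition back_arg g om s := om - turn (fun t => tail g s t - g 0).

Lemma back_argP g om s : cpath g -> 0 < s <= 1 ->
  (forall t, 0 < t <= 1 -> g t <> g 0) -> arg_of (g 1 - g 0) om ->
  arg_of (g s - g 0) (back_arg g om s).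
Proof.
move=> cg /andP[s0 s1] g0 hom.
have s01 : 0 <= s <= 1 by rewrite (ltW s0).
have i0 : 0 <= (0 : R) <= 1 by rewrite lexx ler01.
have i1 : 0 <= (1 : R) <= 1 by rewrite lexx ler01.
have [t t' ht _|A [cA _ hA]] := rect_lift (tail_cpath s cg) (@cpath_cst R (g 0)).
  have /andP[h1 h2] := tail_itv s01 ht.
  by apply: g0; rewrite h2 (lt_le_trans s0).
rewrite /back_arg (turn_lift (A := A^~ 0)) //; last by move=> t ht; exact: hA.
have h1 := hA 1 0 i1 i0; have h0 := hA 0 0 i0 i0.
rewrite tail1 in h1; rewrite tail0 in h0.
have [k ->] := arg_mod h1 hom.
rewrite (_ : _ - _ = A 0 0 + (pi *+ 2) *~ k); last by ring.
exact: arg_ofD2kpi.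
Qed.

(** It depends on the whole arcs and on no radius; this is what makes the cyclic order of first hits
    the same on all small circles. *)
Definition corner_shift g d om om' :=
  om - om' + turn (fun t => d t - g 1) - turn (fun t => g t - d 1) - pi.

(** The argument of [g s - d t] is lifted over the two rectangles [s >= s0] and [t >= t0]. Agreement
    of the lifts on the overlap leaves only their variation before the first hits, which is
    controlled by half planes. *)
Lemma cornerP g d om om' r s0 t0 : cpath g -> cpath d -> g 0 = d 0 ->
  (forall s t, 0 <= s <= 1 -> 0 <= t <= 1 -> 0 < s \/ 0 < t -> g s <> d t) ->
  first_time g r s0 -> first_time d r t0 ->
  arg_of (g 1 - g 0) om -> arg_of (d 1 - d 0) om' ->
  (exists k : int, corner_shift g d om om' = (pi *+ 2) *~ k) /\
  0 < back_arg g om s0 - back_arg d om' t0 - corner_shift g d om om' < pi *+ 2.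
Proof.
move=> cg cd gd0 gd [s00 s01 gs hgs] [t00 t01 dt hdt] hom hom'.
have i0 : 0 <= (0 : R) <= 1 by rewrite lexx ler01.
have i1 : 0 <= (1 : R) <= 1 by rewrite lexx ler01.
have is0 : 0 <= s0 <= 1 by rewrite (ltW s00).
have it0 : 0 <= t0 <= 1 by rewrite (ltW t00).
have [s t hs ht|A1 [cA11 cA12 hA1]] := rect_lift (tail_cpath s0 cg) cd.
  have /andP[h1 h2] := tail_itv is0 hs.
  by apply: gd => //; [rewrite h2 (le_trans (ltW s00))|left; rewrite (lt_le_trans s00)].
have [s t hs ht|A2 [cA21 cA22 hA2]] := rect_lift cg (tail_cpath t0 cd).
  have /andP[h1 h2] := tail_itv it0 ht.
  by apply: gd => //; [rewrite h2 (le_trans (ltW t00))|right; rewrite (lt_le_trans t00)].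
have x1 : turn (fun t => tail g s0 t - g 0) = A1 1 0 - A1 0 0.
  by rewrite (turn_lift (A := A1^~ 0)) // => t ht; rewrite gd0; exact: hA1.
have x2 : turn (fun t => d t - g 1) = A1 1 1 - A1 1 0.
  rewrite turn_sub_opp (turn_lift (A := A1 1)) // => t ht.
  by rewrite -(tail1 g s0); exact: hA1.
have x3 : turn (fun t => tail d t0 t - d 0) = A2 0 1 - A2 0 0.
  rewrite turn_sub_opp (turn_lift (A := A2 0)) // => t ht.
  by rewrite -gd0; exact: hA2.
have x4 : turn (fun t => g t - d 1) = A2 1 1 - A2 0 1.
  rewrite (turn_lift (A := A2^~ 1)) // => t ht.
  by rewrite -(tail1 d t0); exact: hA2.
(* [x5] and [x6] equate the increments of the two lifts on the sides [s = s0] and [t = 1] of the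
   overlap. *)
have x5 : A1 0 1 - A1 0 t0 = A2 s0 1 - A2 s0 0.
  rewrite -(@turn_lift_from _ (fun t => g s0 - d t) (A1 0)) //; last first.
    by move=> t ht; rewrite -(tail0 g s0); exact: hA1.
  rewrite -(@turn_lift _ (fun t => g s0 - tail d t0 t) (A2 s0)) //.
  by move=> t ht; exact: hA2.
have x6 : A1 1 1 - A1 0 1 = A2 1 1 - A2 s0 1.
  rewrite -(@turn_lift_from _ (fun t => g t - d 1) (A2^~ 1)) //; last first.
    by move=> t ht; rewrite -(tail1 d t0); exact: hA2.
  rewrite -(@turn_lift _ (fun t => tail g s0 t - d 1) (A1^~ 1)) //.
  by move=> t ht; exact: hA1.
have near g' d' (s t r' : R) : g' 0 = d' 0 -> sqdist (g' s) (g' 0) = r ^+ 2 ->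
    sqdist (d' t) (d' 0) <= r ^+ 2 -> g' s <> d' t ->
    0 < dotp (g' s - d' 0) (g' s - d' t).
  move=> e0 es et ne; have -> : g' s - d' t = (g' s - d' 0) - (d' t - d' 0).
    by rewrite opprB addrA subrK.
  apply: dotp_chord; last by rewrite -!sqdistE -{2}e0 es.
  by move/addIr.
(* Up to its first hit, [d] stays in the disc whose boundary contains [g s0], so [g s0 - d t] moves
   by less than a quarter turn; [hp2] exchanges the two arcs. *)
have hp1 : - (pi / 2) < A1 0 t0 - A1 0 0 < pi / 2.
  apply: (@half_plane (fun t => g s0 - d t)) => //; first exact: ltW.
    move=> t /andP[h1 h2]; rewrite -(tail0 g s0); apply: hA1 => //.
    by rewrite h1 (le_trans h2).
  move=> t /andP[h1 h2]; apply: near => //; last first.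
    by apply: gd; rewrite ?h1 ?(le_trans h2) //; left.
  by move: h2; rewrite le_eqVlt => /predU1P[->|h2]; [rewrite dt|rewrite ltW // hdt // h1].
have hp2 : - (pi / 2) < A2 s0 0 - A2 0 0 < pi / 2.
  apply: (@half_plane (fun s => g s - d t0) (A2^~ 0)) => //; first exact: ltW.
    move=> s /andP[h1 h2]; rewrite -(tail0 d t0); apply: hA2 => //.
    by rewrite h1 (le_trans h2).
  move=> s /andP[h1 h2].
  have := near d g t0 s r; rewrite -gd0 => /(_ erefl).
  have -> : dotp (d t0 - g 0) (d t0 - g s) = dotp (g 0 - d t0) (g s - d t0).
    by rewrite /dotp /=; ring.
  apply => //; first by rewrite gd0.
    by move: h2; rewrite le_eqVlt => /predU1P[->|h2]; [rewrite gs|rewrite ltW // hgs // h1].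
  by apply/nesym; apply: gd; rewrite ?h1 ?(le_trans h2) //; right.
have d_ne t : 0 < t <= 1 -> d t <> d 0.
  by move=> /andP[h1 h2]; rewrite -gd0; apply/nesym; apply: gd; [exact: i0|rewrite h2 ltW|right].
have g_ne t : 0 < t <= 1 -> g t <> g 0.
  by move=> /andP[h1 h2]; rewrite gd0; apply: gd; [rewrite h2 ltW|exact: i0|left].
have b1 := back_argP cg (introT andP (conj s00 s01)) g_ne hom.
have b2 := back_argP cd (introT andP (conj t00 t01)) d_ne hom'.
have E : back_arg g om s0 - back_arg d om' t0 - corner_shift g d om om' =
  (A1 0 0 - A1 0 t0) + (A2 s0 0 - A2 0 0) + pi.
  by rewrite /back_arg /corner_shift x1 x2 x3 x4; lra.
split; last by rewrite E mulr2n; lra.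
have [k1 e1] : exists k : int, back_arg g om s0 = A1 0 0 + (pi *+ 2) *~ k.
  by apply: arg_mod b1; rewrite gd0 -(tail0 g s0); exact: hA1.
have [k2 e2] : exists k : int, back_arg d om' t0 + pi = A2 0 0 + (pi *+ 2) *~ k.
  apply: arg_mod (arg_opp b2); rewrite opprB -gd0 -{1}(tail0 d t0); exact: hA2.
have [k3 e3] : exists k : int, A1 0 t0 = A2 s0 0 + (pi *+ 2) *~ k.
  apply: (@arg_mod _ (g s0 - d t0)).
    by rewrite -(tail0 d t0); exact: hA2.
  by rewrite -{1}(tail0 g s0); exact: hA1.
exists (k1 - k2 + k3); rewrite !mulrzDr mulrNz; lra.
Qed.

End Corner.

(** * First hits on a circle and their counterclockwise order *)

Section FirstTime.
Local Open Scope classical_set_scope.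
Local Open Scope ring_scope.
Variable R : realType.
Implicit Types (g : R -> R * R) (r s t : R).

Lemma sqdist_continuous g (u : R * R) : cpath g -> continuous (fun t => sqdist (g t) u).
Proof.
move=> [g1 g2] t.
have h1 := continuousB (g1 t) (@cst_continuous R R u.1 t).
have h2 := continuousB (g2 t) (@cst_continuous R R u.2 t).
have := continuousD (continuousM h1 h1) (continuousM h2 h2).
by apply: cvg_trans; apply: near_eq_cvg; near=> x; rewrite /sqdist !expr2.
Unshelve. all: by end_near. Qed.

(** It is the least time at distance at least [r], which exists by compactness; the intermediate
    value theorem gives distance exactly [r] there. *)
Lemma first_time_exists g r : cpath g -> 0 < r -> r ^+ 2 <= sqdist (g 1) (g 0) ->
  exists s, first_time g r s.
Proof.
move=> cg r0 hr; set f := fun t => sqdist (g t) (g 0).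
have cf : continuous f by exact: sqdist_continuous.
have f0 : f 0 = 0 by rewrite /f /sqdist !subrr expr0n /= addr0.
pose K := `[(0 : R), 1] `&` f @^-1` [set x | r ^+ 2 <= x].
have cK : compact K.
  apply: (subclosed_compact _ (@segment_compact R 0 1)); last by move=> x [].
  apply: closedI; first exact: interval_closed.
  by apply: closed_comp; [move=> x _; exact: cf|exact: closed_ge].
have K1 : K 1 by split; rewrite //= in_itv /= ler01 lexx.
have cid : continuous (fun x : R => x) by move=> x; exact: cvg_id.
have [c /set_mem[c01 fc] hc] := compact_EVT_min (ex_intro _ 1 K1) cK (continuous_subspaceT cid).
rewrite /= in_itv /= in c01; move/andP: c01 => [c0 c1].
have c_gt0 : 0 < c.
  rewrite lt_neqAle c0 andbT; apply/negP => /eqP e; move: fc.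
  by rewrite /= -e f0 leNgt exprn_gt0.
have below t : 0 <= t < c -> f t < r ^+ 2.
  move=> /andP[t0 tc]; rewrite ltNge; apply/negP => ft.
  have /hc : t \in K by rewrite inE; split => //=; rewrite in_itv /= t0 (le_trans (ltW tc)).
  by rewrite /= leNgt tc.
exists c; split => //.
apply/eqP; rewrite eq_le fc andbT leNgt; apply/negP => h.
have hm : Num.min (f 0) (f c) <= r ^+ 2 <= Num.max (f 0) (f c).
  by rewrite f0 ge_min le_max sqr_ge0 (ltW h) orbT.
have [t] := IVT c0 (continuous_subspaceT cf) hm.
rewrite in_itv /= => /andP[t0 tc] ft.
move: tc; rewrite le_eqVlt => /predU1P[e|tc].
  by move: h; rewrite -/(f c) -e ft ltxx.
by have := below t; rewrite t0 tc ft ltxx => /(_ isT).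
Qed.

(** The expression equals [4 sin (x/2) sin (y/2) sin ((x + y)/2)], twice the area of a triangle
    inscribed in the unit circle. *)
Lemma sin_triple (x y : R) : 0 < x -> 0 < y -> x + y < pi *+ 2 ->
  0 < sin x + sin y - sin (x + y).
Proof.
move=> x0 y0 xy; set a := x / 2; set b := y / 2.
have ea : x = a *+ 2 by rewrite /a mulr2n; lra.
have eb : y = b *+ 2 by rewrite /b mulr2n; lra.
rewrite mulr2n in xy.
have sa : 0 < sin a by apply: sin_gt0_pi; rewrite /a; apply/andP; split; lra.
have sb : 0 < sin b by apply: sin_gt0_pi; rewrite /b; apply/andP; split; lra.
have sab : 0 < sin (a + b).
  by apply: sin_gt0_pi; rewrite /a /b; apply/andP; split; lra.
rewrite ea eb -mulrnDl !sin_mulr2n cosD [sin (a + b)]sinD.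
have ca := cos2sin2 a; have cb := cos2sin2 b.
have -> : (cos a * sin a) *+ 2 + (cos b * sin b) *+ 2 -
  ((cos a * cos b - sin a * sin b) * (sin a * cos b + cos a * sin b)) *+ 2 =
  2 * sin a * cos a * (1 - cos b ^+ 2) + 2 * sin b * cos b * (1 - cos a ^+ 2) +
  2 * sin a * sin b * (sin a * cos b + cos a * sin b) by ring.
rewrite -!sin2cos2.
have -> : 2 * sin a * cos a * sin b ^+ 2 + 2 * sin b * cos b * sin a ^+ 2 +
  2 * sin a * sin b * (sin a * cos b + cos a * sin b) =
  4 * (sin a * sin b * (sin a * cos b + cos a * sin b)) by ring.
by rewrite -sinD mulr_gt0 // mulr_gt0 // mulr_gt0.
Qed.

Lemma orient_polar (o p q u : R * R) r a b c : 0 < r ->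
  sqdist p o = r ^+ 2 -> sqdist q o = r ^+ 2 -> sqdist u o = r ^+ 2 ->
  arg_of (p - o) a -> arg_of (q - o) b -> arg_of (u - o) c ->
  a < b -> b < c -> c - a < pi *+ 2 -> 0 < orient p q u.
Proof.
move=> r0 hp hq hu ha hb hc ab bc ca.
have polar z x : sqdist z o = r ^+ 2 -> arg_of (z - o) x ->
    z.1 = o.1 + r * cos x /\ z.2 = o.2 + r * sin x.
  move=> hz [k k0 [e1 e2]].
  have : k ^+ 2 = r ^+ 2.
    rewrite -hz /sqdist e1 e2 !exprMn -mulrDr cos2Dsin2 mulr1 //.
  move/eqP; rewrite eqf_sqr => /orP[/eqP <-|/eqP kr]; last by move: k0; rewrite kr; lra.
  by rewrite -e1 -e2 !subrKC.
have [p1 p2] := polar _ _ hp ha; have [q1 q2] := polar _ _ hq hb.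
have [u1 u2] := polar _ _ hu hc.
rewrite /orient p1 p2 q1 q2 u1 u2.
have := @sin_triple (b - a) (c - b); rewrite !subr_gt0 addrC subrKA => /(_ ab bc ca).
rewrite -subr_gt0 !sinB => h.
have := mulr_gt0 (exprn_gt0 2 r0) h; set X := (X in 0 < X) => hX.
by rewrite -subr_gt0 [ltRHS](_ : _ = X) // /X; ring.
Qed.

End FirstTime.

(** * Darts of a plane embedding *)

Section DartAngles.
Local Open Scope classical_set_scope.
Local Open Scope ring_scope.
Variables (R : realType) (V : finType) (e : rel V).
Hypotheses (e_sym : symmetric e) (e_irrefl : irreflexive e).
Variable G : plane_embedding R e.
Implicit Types (u v w x y : V) (r s t : R).

Let P := Defs.point G.

(** The arc is frozen outside [0, 1], so that it is continuous on the whole line. *)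
Definition garc u v t : R * R := Defs.arc G u v (clamp 0 1 t).

Lemma clamp01 t : 0 <= clamp 0 1 t <= 1.
Proof. exact/clamp_itv/ler01. Qed.

Lemma garc_cpath u v : e u v -> cpath (garc u v).
Proof.
move=> uv.
have cg : continuous (garc u v).
  move=> t; have ct : clamp 0 1 t \in `[(0 : R), 1] by rewrite in_itv /= clamp01.
  have ctz z : clamp 0 1 z \in `[(0 : R), 1] by rewrite in_itv /= clamp01.
  have hA := (subspace_continuousP _ _).1 (arc_continuous (p := G) uv) _ ct.
  have hc : clamp 0 1 x @[x --> t] --> within `[(0 : R), 1] (nbhs (clamp 0 1 t)).
    move=> A hAA; change (nbhs t (fun x : R => A (clamp 0 1 x))).
    have : nbhs t (fun x : R => clamp 0 1 x \in `[(0 : R), 1] -> A (clamp 0 1 x)).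
      exact: (clamp_continuous (@ler01 R) (x := t) hAA).
    by apply: filterS => z; apply; exact: ctz.
  exact: (cvg_comp _ _ hc hA).
by split=> t; [exact: (continuous_comp (cg t) (@cvg_fst _ _ _ _ _))|exact: (continuous_comp (cg t) (@cvg_snd _ _ _ _ _))].
Qed.

Lemma edge_neq u v : e u v -> u <> v.
Proof. by move=> uv uv'; rewrite uv' e_irrefl in uv. Qed.

Lemma garc_in u v t : 0 <= t <= 1 -> garc u v t = Defs.arc G u v t.
Proof. by move=> t01; rewrite /garc clamp_id. Qed.

Lemma garc0 u v : e u v -> garc u v 0 = P u.
Proof. by move=> uv; rewrite garc_in ?lexx ?ler01 // arc_source. Qed.

Lemma garc1 u v : e u v -> garc u v 1 = P v.
Proof. by move=> uv; rewrite garc_in ?lexx ?ler01 // arc_target. Qed.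

Lemma garc_rev u v t : e u v -> 0 <= t <= 1 -> garc v u t = garc u v (1 - t).
Proof.
move=> uv t01; rewrite !garc_in //; last by apply/andP; split; lra.
by rewrite (arc_reverse G uv) // in_itv.
Qed.

Lemma endpoint_cases t : 0 <= t <= 1 -> [\/ t = 0, t = 1 | t \in `]0, 1[].
Proof.
case/andP; rewrite !le_eqVlt => /predU1P[<-|t0]; first by constructor 1.
by case/predU1P => [->|t1]; [constructor 2|constructor 3; rewrite in_itv /= t0].
Qed.

Lemma garc_point u v w t : e u v -> 0 <= t <= 1 -> garc u v t = P w ->
  (t = 0 /\ w = u) \/ (t = 1 /\ w = v).
Proof.
move=> uv t01; have [->|->|ti] := endpoint_cases t01.
- by rewrite garc0 // => /point_inj ->; left.
- by rewrite garc1 // => /point_inj ->; right.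
- by rewrite garc_in // => h; case: (@arc_avoids_points _ _ _ G _ _ w uv t ti h).
Qed.

Lemma garc_meet u v x y s t : e u v -> e x y -> (x, y) <> (u, v) -> (x, y) <> (v, u) ->
  0 <= s <= 1 -> 0 <= t <= 1 -> garc u v s = garc x y t ->
  (s = 0 /\ (t = 0 /\ u = x \/ t = 1 /\ u = y)) \/
  (s = 1 /\ (t = 0 /\ v = x \/ t = 1 /\ v = y)).
Proof.
move=> uv xy n1 n2 s01 t01 h.
have [ts|ts|ti] := endpoint_cases t01.
- rewrite ts garc0 // in h; have [[-> ->]|[-> ->]] := garc_point uv s01 h.
    by left; split => //; left.
  by right; split => //; left.
- rewrite ts garc1 // in h; have [[-> ->]|[-> ->]] := garc_point uv s01 h.
    by left; split => //; right.
  by right; split => //; right.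
- have [ss|ss|si] := endpoint_cases s01.
  + rewrite ss garc0 // in h; have [[t0 ->]|[t1 ->]] := garc_point xy t01 (esym h).
      by left; split => //; left.
    by left; split => //; right.
  + rewrite ss garc1 // in h; have [[t0 ->]|[t1 ->]] := garc_point xy t01 (esym h).
      by right; split => //; left.
    by right; split => //; right.
  + by rewrite !garc_in // in h; case: (@arc_no_crossing _ _ _ G _ _ _ _ uv xy n1 n2 s t si ti h).
Qed.

Definition dart := {p : V * V | e p.1 p.2}.
Definition src (d : dart) : V := (val d).1.
Definition tgt (d : dart) : V := (val d).2.
Implicit Types d f g : dart.

Lemma dartP d : e (src d) (tgt d). Proof. exact: (valP d). Qed.

Lemma dart_inj d f : src d = src f -> tgt d = tgt f -> d = f.
Proof.
rewrite /src /tgt => h1 h2; apply: val_inj.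
by rewrite [LHS]surjective_pairing [RHS]surjective_pairing h1 h2.
Qed.

Lemma rev_proof d : e (tgt d, src d).1 (tgt d, src d).2.
Proof. by rewrite /= e_sym dartP. Qed.

Definition flip d : dart := exist _ (tgt d, src d) (rev_proof d).

Lemma src_rev d : src (flip d) = tgt d. Proof. by []. Qed.
Lemma tgt_rev d : tgt (flip d) = src d. Proof. by []. Qed.
Lemma revK : involutive flip. Proof. by move=> d; exact: dart_inj. Qed.

Definition darc d := garc (src d) (tgt d).

Lemma darc_cpath d : cpath (darc d). Proof. exact/garc_cpath/dartP. Qed.
Lemma darc0 d : darc d 0 = P (src d). Proof. exact/garc0/dartP. Qed.
Lemma darc1 d : darc d 1 = P (tgt d). Proof. exact/garc1/dartP. Qed.

(** Meaningful when [w] is not an end of [d]; at an end there is no lift and the value is 0. *)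
Definition theta d w : R := turn (fun t => darc d t - P w).

Lemma theta_rev d w : theta (flip d) w = - theta d w.
Proof.
rewrite /theta -(turn_rev (fun t => darc d t - P w)); apply: turn_eq => t.
by rewrite in_itv /= => t01; rewrite /darc src_rev tgt_rev garc_rev // dartP.
Qed.

Lemma theta_disjoint d f : src d <> src f -> src d <> tgt f -> tgt d <> src f ->
  tgt d <> tgt f -> theta d (src f) + theta f (tgt d) = theta f (src d) + theta d (tgt f).
Proof.
move=> n1 n2 n3 n4; rewrite /theta -!darc0 -!darc1; apply: turn_rect.
- exact: darc_cpath.
- exact: darc_cpath.
move=> s t s01 t01 h.
have m1 : (src f, tgt f) <> (src d, tgt d) by move=> [/esym].
have m2 : (src f, tgt f) <> (tgt d, src d) by move=> [/esym].
by case: (garc_meet (dartP d) (dartP f) m1 m2 s01 t01 h) => -[_ [[]|[]]].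
Qed.

Lemma darc_corner d f s t : src d = src f -> d <> f -> 0 <= s <= 1 -> 0 <= t <= 1 ->
  0 < s \/ 0 < t -> darc d s <> darc f t.
Proof.
move=> sdf ndf s01 t01 st h.
have m1 : (src f, tgt f) <> (src d, tgt d).
  by move=> [h1 h2]; apply: ndf; apply: dart_inj.
have m2 : (src f, tgt f) <> (tgt d, src d).
  by move=> [h1 h2]; apply: (edge_neq (dartP d)); rewrite sdf h1.
case: (garc_meet (dartP d) (dartP f) m1 m2 s01 t01 h).
- case=> s0 [[t0 _]|[t1 tf]]; first by case: st; rewrite ?s0 ?t0 ltxx.
  by apply: (edge_neq (dartP f)); rewrite -tf.
- case=> s1 [[t0 tf]|[t1 tf]]; first by apply: (edge_neq (dartP d)); rewrite sdf -tf.
  by apply: ndf; apply: dart_inj.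
Qed.

(** Up to this radius every edge reaches the circle around its source, since it ends at another
    vertex. *)
Lemma separation : exists2 r : R, 0 < r &
  forall v w, v <> w -> r ^+ 2 <= sqdist (P w) (P v).
Proof.
exists (\big[Num.min/1]_(p : V * V | p.1 != p.2) Num.sqrt (sqdist (P p.2) (P p.1))).
  apply: lt_bigmin => // -[v w] /= /eqP vw; rewrite sqrtr_gt0 sqdistE.
  by apply: dotpp_gt0 => /eqP; rewrite subr_eq0 => /eqP /point_inj /esym.
move=> v w vw; rewrite -[leRHS]sqr_sqrtr; last by rewrite addr_ge0 // sqr_ge0.
rewrite lerXn2r // ?nnegrE ?sqrtr_ge0 //.
  by apply/ltW; apply: lt_bigmin => // -[v' w'] /= /eqP vw'; rewrite sqrtr_gt0 sqdistE;
    apply: dotpp_gt0 => /eqP; rewrite subr_eq0 => /eqP /point_inj /esym.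
by apply: (@bigmin_le_cond _ _ _ _ (v, w)); apply/eqP.
Qed.

(** [om] is an argument of the vector from source to target, and [al] the angle of the first hit at
    radius [rho] obtained from it by unwinding; [om] is normalised so that [al] lies in [0, 2 pi).
    The third clause computes the corner shift as 0 or minus a full turn according to the order of
    [al], which carries this order to all smaller radii. *)
Lemma dart_angles : exists (om al : dart -> R), [/\
  forall d, 0 <= al d < pi *+ 2,
  forall d f, src d = src f -> d <> f -> al d <> al f,
  forall d f, src d = src f -> d <> f ->
    om d + theta f (tgt d) = pi + om f + theta d (tgt f) - (pi *+ 2) *+ (al d < al f)%R &
  exists2 rho : R, 0 < rho & forall r, 0 < r <= rho -> exists p : dart -> R * R,
    (forall d, first_hit (P (src d)) r (Defs.arc G (src d) (tgt d)) (p d)) /\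
    (forall d f g, src d = src f -> src f = src g -> al d < al f -> al f < al g ->
      0 < orient (p d) (p f) (p g))].
Proof.
have [rho rho0 hrho] := separation.
have dne d t : 0 < t <= 1 -> darc d t <> darc d 0.
  move=> /andP[t0 t1]; rewrite darc0 => h; have t01 : 0 <= t <= 1 by rewrite (ltW t0).
  have [[t0' _]|[_ h']] := garc_point (dartP d) t01 h; first by rewrite t0' ltxx in t0.
  exact: (edge_neq (dartP d)).
have ft r d : 0 < r <= rho -> exists s, first_time (darc d) r s.
  move=> /andP[r0 rr]; apply: first_time_exists => //; first exact: darc_cpath.
  rewrite darc0 darc1; apply: le_trans (hrho _ _ (edge_neq (dartP d))).
  by rewrite lerXn2r // nnegrE ltW.
have rr : 0 < rho <= rho by rewrite rho0 lexx.
have /choice[st hst] := fun d => ft rho d rr.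
have /choice[om0 hom0] : forall d, exists a, arg_of (darc d 1 - darc d 0) a.
  move=> d; apply: arg_exists => /eqP; rewrite subr_eq0 => /eqP; apply: dne.
  by rewrite lexx ltr01.
have /choice[k hk] := fun d => floor2pi (back_arg (darc d) (om0 d) (st d)).
pose om d := om0 d + (pi *+ 2) *~ (- k d).
have hom d : arg_of (darc d 1 - darc d 0) (om d) by exact: arg_ofD2kpi.
pose al d := back_arg (darc d) (om d) (st d).
have al01 d : 0 <= al d < pi *+ 2.
  have -> : al d = back_arg (darc d) (om0 d) (st d) - (pi *+ 2) *~ k d; last exact: hk.
  by rewrite /al /back_arg /om mulrNz; ring.
pose N d f := corner_shift (darc d) (darc f) (om d) (om f).
have corner d f r s t : src d = src f -> d <> f -> first_time (darc d) r s ->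
    first_time (darc f) r t -> (exists k : int, N d f = (pi *+ 2) *~ k) /\
    0 < back_arg (darc d) (om d) s - back_arg (darc f) (om f) t - N d f < pi *+ 2.
  move=> sdf ndf h1 h2; apply: (cornerP (darc_cpath d) (darc_cpath f) _ _ h1 h2 (hom d) (hom f)).
    by rewrite !darc0 sdf.
  by move=> s' t'; exact: darc_corner.
have p0 : 0 < (pi : R) by exact: pi_gt0.
have Nval d f : src d = src f -> d <> f -> al d <> al f /\
   N d f = - (pi *+ 2) *+ (al d < al f)%R.
  move=> sdf ndf; have [[m e1]] := corner d f rho _ _ sdf ndf (hst d) (hst f).
  rewrite -/(al d) -/(al f) => h2; have h3 := al01 d; have h4 := al01 f.
  rewrite e1 mulr2n -mulrzl in h2 h3 h4 *.
  have pp : 0 < (pi : R) + pi by rewrite addr_gt0.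
  have m1 : (-2 : R) < m%:~R.
    rewrite ltNge; apply/negP => hm.
    have := ler_wpM2r (ltW pp) hm; lra.
  have m2 : m%:~R < (1 : R).
    rewrite ltNge; apply/negP => hm.
    have := ler_wpM2r (ltW pp) hm; lra.
  (* Since both angles lie in [0, 2 pi), the shift is one of two multiples of the full turn, and the
     bounds [h2] then decide which angle is larger. *)
  have {m1 m2} : m = 0 \/ m = -1.
    have : (-2 < m)%R by rewrite -(ltr_int R).
    have : (m < 1)%R by rewrite -(ltr_int R).
    lia.
  case=> me; rewrite me in h2 *.
    split; first by lra.
    by rewrite (_ : al d < al f = false) ?mulr0n ?mul0r //; apply/negbTE; rewrite -leNgt; lra.
  split; first by lra.
  by rewrite (_ : al d < al f) ?mulr1n; lra.
exists om, al; split => //.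
- by move=> d f sdf ndf; case: (Nval d f sdf ndf).
- move=> d f sdf ndf; have [_] := Nval d f sdf ndf.
  rewrite /N /corner_shift /theta !darc1 mulNrn; lra.
- exists rho => // r hr; have /choice[sr hsr] := fun d => ft r d hr.
  have r0 : 0 < r by case/andP: hr.
  exists (fun d => darc d (sr d)); split=> [d|d f g sdf sfg adf afg].
    have [s0 s1 h1 h2] := hsr d; exists (sr d).
    have s01 : 0 <= sr d <= 1 by rewrite (ltW s0).
    split; rewrite ?in_itv //=; first by rewrite /darc garc_in.
      by rewrite -darc0.
    move=> s; rewrite in_itv /= => /andP[s0' s1'].
    rewrite -(garc_in (src d) (tgt d) (t := s)) ?s0' ?(le_trans (ltW s1')) //.
    by rewrite -darc0; apply: h2; rewrite s0'.
  have val' d' : 0 < sr d' <= 1 by have [-> ->] := hsr d'.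
  have sq d' : src d' = src d -> sqdist (darc d' (sr d')) (P (src d)) = r ^+ 2.
    by move=> <-; rewrite -darc0; have [] := hsr d'.
  have ar d' : src d' = src d -> arg_of (darc d' (sr d') - P (src d)) (back_arg (darc d') (om d') (sr d')).
    by move=> <-; rewrite -darc0; apply: back_argP => //; [exact: darc_cpath|move=> t; exact: dne].
  have ne a b : al a < al b -> a <> b by move=> h hh; rewrite hh ltxx in h.
  have gap a b : src a = src b -> al a < al b ->
     0 < back_arg (darc b) (om b) (sr b) - back_arg (darc a) (om a) (sr a) < pi *+ 2.
    move=> sab hab; have [_ h] := corner a b r _ _ sab (ne _ _ hab) (hsr a) (hsr b).
    have [_ h'] := Nval a b sab (ne _ _ hab).
    by move: h; rewrite h' hab mulr1n mulr2n; lra.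
  have := gap d f sdf adf; have := gap f g sfg afg.
  have := gap d g (etrans sdf sfg) (lt_trans adf afg).
  move=> /andP[h1 h2] /andP[h3 h4] /andP[h5 h6].
  apply: (orient_polar r0 (sq d erefl) (sq f (esym sdf)) (sq g (esym (etrans sdf sfg))) 
    (ar d erefl) (ar f (esym sdf)) (ar g (esym (etrans sdf sfg)))) => //; lra.
Qed.

End DartAngles.

(** * The rotation system: darts around a vertex sorted by angle *)

Section Rotation.
Local Open Scope classical_set_scope.
Local Open Scope ring_scope.
Variables (R : realType) (V : finType) (e : rel V) (al : dart e -> R).
Hypothesis al_inj : forall d f : dart e, src d = src f -> d <> f -> al d <> al f.
Implicit Types d f g : dart e.

Definition darts_at (v : V) : seq (dart e) :=
  sort (fun d f => al d <= al f) [seq d <- enum {: dart e} | src d == v].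

Definition ix d := index d (darts_at (src d)).

Lemma mem_darts_at v d : (d \in darts_at v) = (src d == v).
Proof. by rewrite mem_sort mem_filter mem_enum andbT. Qed.

Lemma darts_at_uniq v : uniq (darts_at v).
Proof. by rewrite sort_uniq; apply: filter_uniq; exact: enum_uniq. Qed.

Lemma size_darts_at v : size (darts_at v) = degree e v.
Proof.
rewrite size_sort -(size_map (@tgt V e)) /degree cardE.
apply: perm_size; apply: uniq_perm; last 2 first.
- exact: enum_uniq.
- move=> w; rewrite mem_enum inE; apply/mapP/idP => [[d]|vw].
    by rewrite mem_filter => /andP[/eqP <- _] ->; exact: dartP.
  by exists (exist _ (v, w) vw); rewrite // mem_filter mem_enum andbT /src /=.
rewrite map_inj_in_uniq; first by apply: filter_uniq; exact: enum_uniq.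
move=> d f; rewrite !mem_filter => /andP[/eqP dv _] /andP[/eqP fv _].
by apply: dart_inj; rewrite dv fv.
Qed.

Lemma ix_lt d : (ix d < degree e (src d))%N.
Proof. by rewrite -size_darts_at index_mem mem_darts_at. Qed.

Lemma nth_ix d0 d : nth d0 (darts_at (src d)) (ix d) = d.
Proof. by rewrite nth_index // mem_darts_at. Qed.

Lemma ix_nth d0 v i : (i < degree e v)%N ->
  src (nth d0 (darts_at v) i) = v /\ ix (nth d0 (darts_at v) i) = i.
Proof.
move=> iv; have : nth d0 (darts_at v) i \in darts_at v by rewrite mem_nth // size_darts_at.
rewrite mem_darts_at => /eqP sv; split=> //.
by rewrite /ix sv index_uniq ?size_darts_at ?darts_at_uniq.
Qed.

Lemma ix_inj d f : src d = src f -> ix d = ix f -> d = f.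
Proof. by move=> sdf h; rewrite -(nth_ix d d) -(nth_ix d f) sdf h. Qed.

Lemma al_ix d f : src d = src f -> (al d < al f) = (ix d < ix f)%N.
Proof.
have mono d' f' : src d' = src f' -> (ix d' < ix f')%N -> al d' < al f'.
  move=> sdf h; rewrite lt_neqAle; apply/andP; split.
    by apply/eqP; apply: al_inj => // df; rewrite df ltnn in h.
  have sd : sorted (fun d f => al d <= al f) (darts_at (src d')).
    by apply: sort_sorted => a b; exact: le_total.
  have := @sorted_leq_nth _ (fun d f => al d <= al f) _ _ d' _ sd (ix d') (ix f').
  rewrite !inE !size_darts_at ix_lt {1}sdf ix_lt => /(_ _ _ isT isT (ltnW h)).
  by rewrite nth_ix sdf nth_ix; apply => // a b c; exact: le_trans.
move=> sdf; apply/idP/idP; last exact: mono.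
move=> h; rewrite ltnNge leq_eqVlt; apply/negP => /orP[/eqP hx|/mono hx].
  by rewrite (ix_inj sdf (esym hx)) ltxx in h.
by have := lt_trans h (hx (esym sdf)); rewrite ltxx.
Qed.

Definition rot_next d := nth d (darts_at (src d)) ((ix d).+1 %% degree e (src d)).

Lemma degree_gt0 d : (0 < degree e (src d))%N.
Proof. exact: leq_ltn_trans (leq0n _) (ix_lt d). Qed.

Lemma src_rot_next d : src (rot_next d) = src d.
Proof. by have [] := ix_nth d (ltn_pmod (ix d).+1 (degree_gt0 d)). Qed.

Lemma ix_rot_next d : ix (rot_next d) = ((ix d).+1 %% degree e (src d))%N.
Proof. by have [] := ix_nth d (ltn_pmod (ix d).+1 (degree_gt0 d)). Qed.

Lemma rot_next_inj : injective rot_next.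
Proof.
move=> d f h; have sdf : src d = src f by rewrite -src_rot_next h src_rot_next.
have := congr1 ix h; rewrite !ix_rot_next sdf -addn1 -[(ix f).+1]addn1 => /eqP.
rewrite eqn_modDr !modn_small ?ix_lt //; last by rewrite -sdf ix_lt.
by move/eqP; exact: ix_inj.
Qed.

Definition rotation : {perm (dart e)} := perm rot_next_inj.

Lemma src_rotation d : src (rotation d) = src d.
Proof. by rewrite permE src_rot_next. Qed.

Lemma src_rotationX i d : src ((rotation ^+ i)%g d) = src d.
Proof. by rewrite permX; elim: i => //= i IH; rewrite src_rotation. Qed.

Lemma ix_rotationX i d : ix ((rotation ^+ i)%g d) = ((ix d + i) %% degree e (src d))%N.
Proof.
elim: i => [|i IH]; first by rewrite expg0 perm1 addn0 modn_small // ix_lt.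
by rewrite expgSr permM [LHS]/ix permE -/(ix _) ix_rot_next src_rotationX IH addnS -addn1 modnDml addn1.
Qed.

Lemma rotation_trans d f : src d = src f -> exists2 i, (i < degree e (src d))%N & f = (rotation ^+ i)%g d.
Proof.
move=> sdf; set n := degree e (src d).
have n0 : (0 < n)%N by exact: degree_gt0.
exists ((ix f + (n - ix d)) %% n)%N; first by rewrite ltn_mod.
apply: ix_inj; first by rewrite src_rotationX.
rewrite ix_rotationX modnDmr addnC -addnA subnK; last exact/ltnW/ix_lt.
by rewrite modnDr modn_small // /n sdf ix_lt.
Qed.

(** The indices of the iterates increase except for one return to 0, so any three are increasing up
    to a cyclic shift, under which [orient] is invariant. *)
Lemma rotation_orient (p : dart e -> R * R) :
  (forall d f g, src d = src f -> src f = src g -> al d < al f -> al f < al g ->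
     0 < orient (p d) (p f) (p g)) ->
  forall d (i j k : nat), (i < j < k)%N -> (k < degree e (src d))%N ->
    0 < orient (p ((rotation ^+ i)%g d)) (p ((rotation ^+ j)%g d)) (p ((rotation ^+ k)%g d)).
Proof.
move=> hp d i j k /andP[ij jk] kn.
have orC (x y z : R * R) : orient x y z = orient y z x by rewrite /orient; ring.
have hn := ix_lt d.
have ixE m : (m < degree e (src d))%N -> ix ((rotation ^+ m)%g d) =
   if (ix d + m < degree e (src d))%N then (ix d + m)%N else (ix d + m - degree e (src d))%N.
  move=> mn; rewrite ix_rotationX; case: ltnP => h; first by rewrite modn_small.
  by rewrite -{1}(subnK h) modnDr modn_small //; lia.
have lt a b : (ix ((rotation ^+ a)%g d) < ix ((rotation ^+ b)%g d))%N ->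
    al ((rotation ^+ a)%g d) < al ((rotation ^+ b)%g d).
  by rewrite al_ix // !src_rotationX.
have s a b : src ((rotation ^+ a)%g d) = src ((rotation ^+ b)%g d) by rewrite !src_rotationX.
have := ixE i (ltn_trans ij (ltn_trans jk kn)); have := ixE j (ltn_trans jk kn).
have := ixE k kn.
have [h1|h1] := ltnP (ix d + i) (degree e (src d));
have [h2|h2] := ltnP (ix d + j) (degree e (src d));
have [h3|h3] := ltnP (ix d + k) (degree e (src d)) => ek ej ei; try (exfalso; lia).
- by apply: hp => //; apply: lt; rewrite ?ek ?ej ?ei; lia.
- by rewrite -orC; apply: hp => //; apply: lt; rewrite ?ek ?ej ?ei; lia.
- by rewrite orC; apply: hp => //; apply: lt; rewrite ?ek ?ej ?ei; lia.
- by apply: hp => //; apply: lt; rewrite ?ek ?ej ?ei; lia.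
Qed.

End Rotation.

(** * Euler's inequality *)

Section Euler.
Local Open Scope classical_set_scope.
Local Open Scope ring_scope.
Variables (R : realType) (V : finType) (e : rel V).
Hypotheses (e_sym : symmetric e) (e_irrefl : irreflexive e).
Variables (om al : dart e -> R) (th : dart e -> V -> R).
Notation flip := (flip e_sym).
Hypothesis al_inj : forall d f : dart e, src d = src f -> d <> f -> al d <> al f.
Hypothesis th_rev : forall d w, th (flip d) w = - th d w.
Hypothesis th_disjoint : forall d f, src d <> src f -> src d <> tgt f -> tgt d <> src f ->
  tgt d <> tgt f -> th d (src f) + th f (tgt d) = th f (src d) + th d (tgt f).
Hypothesis om_corner : forall d f, src d = src f -> d <> f ->
  om d + th f (tgt d) = pi + om f + th d (tgt f) - (pi *+ 2) *+ (al d < al f)%R.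

Notation sg := (rotation al).
Implicit Types d f g : dart e.

Lemma src_neq_tgt d : src d != tgt d.
Proof. by apply/eqP; exact: (edge_neq e_irrefl (dartP d)). Qed.

(* The variation of the argument along [f], seen from a point close to [v] in
   the sector determined by [c], the set of darts lifted by a full turn. *)
Definition sector_turn (v : V) (c : pred (dart e)) f : R :=
  if src f == v then om f + (pi *+ 2) *+ c f
  else if tgt f == v then - (om (flip f) + (pi *+ 2) *+ c (flip f))
  else th f v.

Lemma sector_turn_rev v c f : sector_turn v c (flip f) = - sector_turn v c f.
Proof.
rewrite /sector_turn src_rev tgt_rev th_rev revK.
have := src_neq_tgt f; have [<-|nt] := eqVneq (tgt f) v.
  by move/negbTE => ->; rewrite opprK.
by case: ifP.
Qed.

(** The sectors just after and just before [d] in counterclockwise order; they differ only in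
    whether [d] itself is lifted. *)
Definition left_of d : pred (dart e) := fun f => al f <= al d.
Definition right_of d : pred (dart e) := fun f => al f < al d.

Definition side_shift d (x : V) : R :=
  if x == src d then pi + om d
  else if x == tgt d then - pi - om (flip d) else th d x.

(** The viewpoint travels along the left side of [d]. The turn of [f] changes by the difference of a
    vertex function at its ends, which a circulation does not see. Edges meeting [d] at one end use
    [om_corner], disjoint ones [th_disjoint]. *)
Lemma sector_turn_transport d f :
  sector_turn (tgt d) (right_of (flip d)) f - sector_turn (src d) (left_of d) f =
  side_shift d (tgt f) - side_shift d (src f).
Proof.
have nd := src_neq_tgt d; have nd' : tgt d != src d by rewrite eq_sym.
have key g : (src g == src d) || (src g == tgt d) && (tgt g != src d) ->
    sector_turn (tgt d) (right_of (flip d)) g - sector_turn (src d) (left_of d) g =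
    side_shift d (tgt g) - side_shift d (src g).
  have ng := src_neq_tgt g; have ng' : tgt g != src g by rewrite eq_sym.
  move=> /orP[/eqP sg|/andP[/eqP sg tg]].
  - rewrite sg in ng ng'; rewrite /sector_turn /side_shift sg eqxx (negbTE nd) (negbTE ng').
    have [tgd|tgd] := eqVneq (tgt g) (tgt d).
      have -> : g = d by exact: dart_inj.
      rewrite /right_of /left_of ltxx lexx mulr0n mulr1n; ring.
    have gd : g <> d by move=> h; rewrite h eqxx in tgd.
    have := om_corner sg gd.
    by rewrite /left_of le_eqVlt; have /eqP/negbTE -> /= := al_inj sg gd; lra.
  - have gd : g <> flip d by move=> h; rewrite h tgt_rev eqxx in tg.
    have := om_corner (f := flip d) sg gd; rewrite tgt_rev th_rev.
    rewrite sg in ng ng'; rewrite /sector_turn /side_shift sg eqxx (negbTE nd') (negbTE ng') (negbTE tg).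
    by rewrite /right_of; lra.
have [h|h] := boolP ((src f == src d) || (src f == tgt d) && (tgt f != src d)); first exact: key.
have [h'|h'] := boolP ((tgt f == src d) || (tgt f == tgt d) && (src f != src d)).
  by have := key (flip f); rewrite !sector_turn_rev src_rev tgt_rev => /(_ h'); lra.
move: h h'; rewrite !negb_or !negb_and !negbK => /andP[h1 h2] /andP[h3 h4].
rewrite (negbTE h3) orbF in h2; rewrite (negbTE h1) orbF in h4.
rewrite /sector_turn /side_shift (negbTE h1) (negbTE h2) (negbTE h3) (negbTE h4).
by have := @th_disjoint f d (elimN eqP h1) (elimN eqP h2) (elimN eqP h3) (elimN eqP h4); lra.
Qed.

Section Circulation.
Variable y : dart e -> R.
Hypothesis y_rev : forall d, y (flip d) = - y d.
Hypothesis y_div : forall v, \sum_(d | src d == v) y d = 0.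

Lemma circ_src (h : V -> R) : \sum_d y d * h (src d) = 0.
Proof.
rewrite (partition_big (@src _ e) xpredT) //= big1 // => v _.
under eq_bigr => d /eqP -> do [].
by rewrite -mulr_suml y_div mul0r.
Qed.

Lemma circ_tgt (h : V -> R) : \sum_d y d * h (tgt d) = 0.
Proof.
rewrite (reindex_inj (inv_inj (revK e_sym))) /=.
under eq_bigr => d _ do rewrite y_rev tgt_rev mulNr.
by rewrite sumrN circ_src oppr0.
Qed.

(** Every edge enters through both of its darts, so a unit of flow crossed by the viewpoint counts
    [pi *+ 4], two full turns. *)
Definition winding v c := \sum_f y f * sector_turn v c f.

Lemma windingB v (c c' : pred (dart e)) (x : dart e -> R) :
  (forall f, src f = v -> (c f : nat)%:R - (c' f : nat)%:R = x f :> R) ->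
  winding v c - winding v c' = (pi *+ 4) * \sum_(f | src f == v) y f * x f.
Proof.
move=> hx; rewrite /winding -sumrB.
under eq_bigr => f _ do rewrite -mulrBr.
have E f : sector_turn v c f - sector_turn v c' f =
    (pi *+ 2) * ((if src f == v then x f else 0) - (if tgt f == v then x (flip f) else 0)).
  rewrite /sector_turn; have := src_neq_tgt f.
  have [sv|sv] := eqVneq (src f) v.
    rewrite sv eq_sym => /negbTE ->; rewrite -hx // subr0 -[_ *+ c f]mulr_natr -[_ *+ c' f]mulr_natr; lra.
  have [tv|tv] := eqVneq (tgt f) v => _; last by rewrite !subrr mulr0.
  rewrite -hx ?src_rev // -[_ *+ c _]mulr_natr -[_ *+ c' _]mulr_natr; lra.
under eq_bigr => f _ do rewrite E mulrCA mulrBr.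
rewrite -mulr_sumr sumrB.
have -> : \sum_f y f * (if src f == v then x f else 0) = \sum_(f | src f == v) y f * x f.
  by rewrite [RHS]big_mkcond /=; apply: eq_bigr => f _; case: ifP; rewrite ?mulr0.
have -> : \sum_f y f * (if tgt f == v then x (flip f) else 0) = - \sum_(f | src f == v) y f * x f.
  rewrite (reindex_inj (inv_inj (revK e_sym))) /= [in RHS]big_mkcond /= -sumrN.
  by apply: eq_bigr => f _; rewrite tgt_rev revK y_rev; case: ifP; rewrite ?mulr0 ?oppr0 // mulNr.
by ring.
Qed.

Definition side d := winding (src d) (left_of d).

Lemma side_transport d : side d = winding (tgt d) (right_of (flip d)).
Proof.
apply/eqP; rewrite eq_sym -subr_eq0 /side /winding -sumrB.
under eq_bigr => f _ do rewrite -mulrBr sector_turn_transport mulrBr.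
by rewrite sumrB circ_src circ_tgt subrr.
Qed.

Lemma side_jump d : side d - side (flip d) = (pi *+ 4) * y d.
Proof.
rewrite [side (flip d)]side_transport tgt_rev revK /side.
rewrite (windingB (x := fun f => (f == d)%:R)).
  rewrite (bigD1 d) //= eqxx mulr1 big1 ?addr0 // => f /andP[_ /negbTE ->].
  by rewrite mulr0.
move=> f sf; rewrite /left_of /right_of le_eqVlt.
have [->|fd] := eqVneq f d; first by rewrite eqxx ltxx subr0.
by have /eqP/negbTE -> /= := al_inj sf (elimN eqP fd); rewrite subrr.
Qed.

(** Both sides describe the sector between [d] and the next dart. If [d] is last in the list, the
    descriptions differ by a full turn of all darts at the vertex, whose flows add up to 0. *)
Lemma side_rotation d : side d = winding (src d) (right_of (sg d)).
Proof.
apply/eqP; rewrite -subr_eq0 /side.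
have hs f : src f = src d -> left_of d f = (ix al f <= ix al d)%N.
  by move=> sf; rewrite /left_of leNgt (@al_ix R V e al al_inj) // -leqNgt.
have hr f : src f = src d -> right_of (sg d) f = (ix al f < (ix al d).+1 %% degree e (src d))%N.
  by move=> sf; rewrite /right_of (@al_ix R V e al al_inj) ?(src_rotation al) // permE ix_rot_next.
have := ix_lt al d; rewrite leq_eqVlt => /predU1P[hl|hl].
- rewrite (windingB (x := fun=> 1)) ?mulr1.
    by rewrite (eq_bigr y) ?y_div ?mulr0 // => f _; rewrite mulr1.
  move=> f sf; rewrite hs // hr // hl modnn ltn0 subr0.
  by have := ix_lt al f; rewrite sf -hl ltnS => ->.
- rewrite (windingB (x := fun=> 0)).
    by rewrite big1 ?mulr0 // => f _; rewrite mulr0.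
  by move=> f sf; rewrite hs // hr // modn_small // subrr.
Qed.

End Circulation.

Lemma rev_inj : injective flip. Proof. exact: inv_inj (revK e_sym). Qed.

Definition face_next : {perm dart e} := (perm rev_inj * sg^-1)%g.

Lemma face_nextE d : face_next d = (sg^-1)%g (flip d).
Proof. by rewrite /face_next permM (permE rev_inj). Qed.

Lemma side_face y d : (forall d, y (flip d) = - y d) ->
  (forall v, \sum_(d | src d == v) y d = 0) -> side y (face_next d) = side y d.
Proof.
move=> y1 y2; rewrite face_nextE [RHS](side_transport y1 y2).
rewrite (side_rotation y1 y2) permKV; congr winding.
by rewrite -(src_rotation al ((sg^-1)%g (flip d))) permKV.
Qed.

Lemma side_porbit y d f : (forall d, y (flip d) = - y d) ->
  (forall v, \sum_(d | src d == v) y d = 0) -> f \in porbit face_next d -> side y f = side y d.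
Proof.
move=> y1 y2 /porbitP[i ->]; elim: i => [|i IH]; first by rewrite expg0 perm1.
by rewrite expgSr permM side_face.
Qed.

Definition edge_rep d := (enum_rank d < enum_rank (flip d))%N.

Lemma edge_repN d : edge_rep (flip d) = ~~ edge_rep d.
Proof.
rewrite /edge_rep revK -leqNgt ltn_neqAle; case: eqP => //= h.
have hd := enum_rank_inj (ord_inj h).
by have := src_neq_tgt d; rewrite -src_rev hd eqxx.
Qed.

Lemma card_darts : #|{: dart e}| = (#|[pred d | edge_rep d]|).*2.
Proof.
rewrite -(cardC [pred d | edge_rep d]) -addnn; congr (_ + _)%N.
rewrite -(fintype.card_image rev_inj [pred d | edge_rep d]); apply: eq_card => d.
apply/idP/fintype.imageP => [|[f]]; rewrite !inE; first by exists (flip d); rewrite ?revK // inE edge_repN.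
by move=> h ->; rewrite edge_repN negbK.
Qed.

(** The left kernel of the incidence matrix [K] is the space of circulations, of dimension at least
    E - V. It lies in the row space of [L], whose F rows add up to 0 and so have rank below F. *)
Theorem euler_inequality : (0 < #|{: dart e}|)%N ->
  (#|{: dart e}| < (#|V| + #|porbits face_next|).*2)%N.
Proof.
move=> /card_gt0P[dd _].
rewrite card_darts ltn_double.
pose E := [pred d | edge_rep d]; pose F := porbits face_next.
pose ev (i : 'I_#|E|) : dart e := enum_val i.
have ev_rep i : edge_rep (ev i) by have := enum_valP i; rewrite inE.
pose K : 'M[R]_(#|E|, #|V|) := \matrix_(i, j)
  ((src (ev i) == enum_val j)%:R - (tgt (ev i) == enum_val j)%:R).
have fF d : porbit face_next d \in F by apply: imset_f.
pose L : 'M[R]_(#|F|, #|E|) := \matrix_(f, i)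
  ((enum_val f == porbit face_next (ev i))%:R - (enum_val f == porbit face_next (flip (ev i)))%:R).
have sumF (h : {set dart e} -> R) d :
    \sum_(f < #|F|) h (enum_val f) * (enum_val f == porbit face_next d)%:R = h (porbit face_next d).
  rewrite (bigD1 (enum_rank_in (fF d) (porbit face_next d))) //= enum_rankK_in // eqxx mulr1.
  rewrite big1 ?addr0 // => f hf; case: eqP => h'; last by rewrite mulr0.
  by case/eqP: hf; apply: enum_val_inj; rewrite h' enum_rankK_in.
have rL : (\rank L < #|F|)%N.
  rewrite ltn_neqAle rank_leq_row andbT; apply/negP => /eqP hL.
  have rf : row_free L by rewrite /row_free hL.
  have f0 : (0 < #|F|)%N by apply/card_gt0P; exists (porbit face_next dd).
  have : (const_mx 1 : 'rV[R]_#|F|) *m L = 0 *m L.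
    rewrite mul0mx; apply/rowP => i; rewrite !mxE.
    under eq_bigr => f _ do rewrite !mxE mulrBr.
    by rewrite sumrB !(sumF (fun=> 1)) subrr.
  move/(row_free_inj rf)/rowP/(_ (Ordinal f0)); rewrite !mxE => /eqP.
  by rewrite oner_eq0.
have hK : (kermx K <= L)%MS.
  apply/rV_subP => x /sub_kermxP xK.
  (* A row vector on the chosen darts becomes an antisymmetric function on all darts. *)
  pose y d := \sum_i x 0 i * ((ev i == d)%:R - (ev i == flip d)%:R).
  have y_rev d : y (flip d) = - y d.
    by rewrite /y revK -sumrN; apply: eq_bigr => i _; rewrite -mulrN opprB.
  have y_div v : \sum_(d | src d == v) y d = 0.
    have := congr1 (fun A : 'rV_#|V| => A 0 (enum_rank v)) xK; rewrite !mxE.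
    rewrite /y exchange_big /= => h; rewrite -[RHS]h; apply: eq_bigr => i _.
    rewrite -mulr_sumr mxE enum_rankK; congr (_ * _); rewrite sumrB; congr (_ - _).
      rewrite big_mkcond /= (bigD1 (ev i)) //= eqxx big1 ?addr0; first by case: ifP.
      by move=> d /negbTE h'; rewrite [ev i == d]eq_sym h'; case: ifP.
    rewrite big_mkcond /= (bigD1 (flip (ev i))) //= revK eqxx src_rev big1 ?addr0; first by case: ifP.
    move=> d h'; rewrite (_ : (ev i == flip d) = false); first by case: ifP.
    by apply/negbTE; apply: contra h' => /eqP ->; rewrite revK.
  have y_ev i : y (ev i) = x 0 i.
    rewrite /y (bigD1 i) //= eqxx big1.
      have -> : (ev i == flip (ev i)) = false.
        apply/negbTE/eqP => h; have := src_neq_tgt (ev i).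
        by rewrite -src_rev -h eqxx.
      by rewrite subr0 mulr1 addr0.
    move=> j hj; have -> : (ev j == ev i) = false.
      by apply/negbTE; apply: contra hj => /eqP /enum_val_inj ->.
    have -> : (ev j == flip (ev i)) = false.
      by apply/negbTE/eqP => h; have := ev_rep j; rewrite h edge_repN ev_rep.
    by rewrite subrr mulr0.
  pose U (A : {set dart e}) : R := if [pick d in A] is Some d then side y d else 0.
  have UE d : U (porbit face_next d) = side y d.
    rewrite /U; case: pickP => [f hf|h]; first exact: side_porbit.
    by have := h d; rewrite porbit_id.
  (* By [side_jump] the flow is the difference of the values on the two adjacent faces, divided by
     [pi *+ 4]. *)
  apply/submxP; exists ((pi *+ 4)^-1 *: \row_f U (enum_val f)).
  rewrite -scalemxAl; apply/rowP => i; rewrite !mxE.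
  under eq_bigr => f _ do rewrite !mxE mulrBr.
  rewrite sumrB !sumF !UE (side_jump y_rev y_div) y_ev mulKf //.
  by rewrite mulrn_eq0 /= gt_eqF // pi_gt0.
have := mxrankS hK; rewrite mxrank_ker => h.
have := rank_leq_col K; move: h rL; rewrite -/E -/F; lia.
Qed.

End Euler.

(** * From the embedding to a combinatorial map *)

Section PlaneRotation.
Local Open Scope classical_set_scope.
Local Open Scope ring_scope.

Theorem plane_rotation (R : realType) (V : finType) (e : rel V)
    (e_sym : symmetric e) (e_irrefl : irreflexive e) (G : plane_embedding R e) :
  exists s : {perm (dart e)}, [/\ forall d, src (s d) = src d,
    forall d f, src d = src f -> exists2 i, (i < degree e (src d))%N & f = (s ^+ i)%g d,
    (0 < #|{: dart e}|)%N ->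
      (#|{: dart e}| < (#|V| + #|porbits (perm (@rev_inj V e e_sym) * s^-1)%g|).*2)%N &
    forall d n, n = degree e (src d) ->
      ccw_around G (src d) (fun i : 'I_n => tgt ((s ^+ i)%g d))].
Proof.
have [om [al [_ al_inj corner [rho rho0 hits]]]] := dart_angles e_irrefl G.
exists (rotation al); split.
- exact: src_rotation.
- exact: rotation_trans.
- exact: (euler_inequality e_irrefl al_inj (theta_rev e_sym G) (@theta_disjoint _ _ _ G) corner).
- move=> d n ->; near=> r.
  have hr : 0 < r <= rho.
    have h1 : 0 < r by near: r; exact: nbhs_right_gt.
    by rewrite h1; near: r; exact: nbhs_right_le.
  have [p [p1 p2]] := hits r hr.
  exists (fun i => p ((rotation al ^+ i)%g d)); split.
    by move=> i; have := p1 ((rotation al ^+ i)%g d); rewrite src_rotationX.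
  by move=> i j k ijk; apply: (rotation_orient al_inj p2).
Unshelve. all: by end_near. Qed.

End PlaneRotation.

(** * Degree classes and the local inequality at a 5-vertex *)

Ltac bsimpl := cbv beta iota delta [andb orb negb].

Section StarCheck.
Local Open Scope Z_scope.

(** Each threshold opens a class: class 0 is degree 5, class 1 degree 6, and class 12 contains the
    degrees from 24 on. *)
Definition thresholds := [:: 6; 7; 8; 9; 10; 11; 12; 14; 15; 16; 18; 24]%N.

Definition cls (d : nat) : nat := count (fun t => t <= d)%N thresholds.

(** Half of [1 - 6/d] in units of 1/18480, where [d >= 8] is the least degree of the class. *)
Definition half_gain (a : nat) : Z :=
  nth 0 [:: 0; 0; 0; 2310; 3080; 3696; 4200; 4620; 5280; 5544; 5775; 6160; 6930] a.

(** Through a triangle, [a] gives its full amount to the centre, or half if the other neighbour [b]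
    has degree 5 and takes the other half. *)
Definition part (a b : nat) : Z := if b == 0%N then half_gain a else 2 * half_gain a.
Definition tri_share (a b : nat) : Z := part a b + part b a.
(** On a non-triangular face the corner at the neighbour received 1/2 from the face and passes it
    on; the worst case is assumed, where the centre gets only half of everything. *)
Definition big_part (a : nat) : Z := if a == 0%N then 0 else half_gain a + 4620.
Definition big_share (a b : nat) : Z := 9240 + big_part a + big_part b.
Definition seven_gift (p a n : nat) : Z :=
  if (a == 2%N) && ~~ ((p == 0%N) && (n == 0%N)) then 4620 else 0.

(** Classes 2, 3, 4 are the degrees 7, 8, 9 of [u]; classes 9 to 12 of [z] begin at the degrees 15,
    16, 18, 24. *)
Definition claim (u z : nat) : Z :=
  if (u == 2%N) && (z == 12%N) then 4620
  else if (u == 3%N) && ((z == 10%N) || (z == 11%N)) then 2310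
  else if (u == 4%N) && ((z == 9%N) || (z == 10%N)) then 1232 else 0.
(* Bounds for a claim as seen by the donor: the far one (called a in the header)
   only knows z, the near one (b) only knows u. *)
Definition claim_far (z : nat) : Z := nth 0 [:: 0; 0; 0; 0; 0; 0; 0; 0; 0; 1232; 2310; 2310; 4620] z.
Definition claim_near (u : nat) : Z := nth 0 [:: 0; 0; 4620; 2310; 1232] u.

Definition claim_at (c0 c1 c2 c3 c4 : nat) : Z :=
  if [&& c0 == 0%N, c1 == 0%N & c3 == 0%N] then claim c2 c4 else 0.
(** Seen from the donor, [c] is the claimant, [p1] the other possible donor and [n1] stands for [z].
    The flag [t] says whether the face beyond the two donors is a triangle, with third vertex [p2].
    In [pay_near] the other donor is [n1], the third vertex [n2], and [p1] stands for [u]. *)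
Definition pay_far (t : bool) (p2 p1 c n1 : nat) : Z :=
  if [&& c == 0%N, p1 == 0%N & ~~ t || (7 <= p2)%N] then claim_far n1 else 0.
Definition pay_near (p1 c n1 n2 : nat) : Z :=
  if [&& c == 0%N, n1 == 0%N & (n2 < 7)%N] then claim_near p1 else 0.

Definition claims (p2 p1 c n1 n2 : nat) : Z :=
  claim_at c n1 n2 p2 p1 + claim_at c p1 p2 n2 n1.
Definition pays (t t' : bool) (p2 p1 c n1 n2 : nat) : Z :=
  pay_far t p2 p1 c n1 + pay_near p1 c n1 n2 +
  (pay_far t' n2 n1 c p1 + pay_near n1 c p1 p2).

Definition own_term (p a n : nat) : Z := part a p + part a n + seven_gift p a n.

Definition base_charge (a b c d f : nat) : Z :=
  own_term f a b + own_term a b c + own_term b c d + own_term c d f + own_term d f a - 18480.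

Definition all_claims (a b c d f : nat) : Z :=
  claims d f a b c + claims f a b c d + claims a b c d f + claims b c d f a + claims c d f a b.

Definition all_pays (a b c d f : nat) : Z :=
  pays true true d f a b c + pays true true f a b c d + pays true true a b c d f +
  pays true true b c d f a + pays true true c d f a b.

Definition tri_charge (a b c d f : nat) : Z :=
  base_charge a b c d f + all_claims a b c d f - all_pays a b c d f.

(* What a non-triangular corner between the first two neighbours brings beyond
   the triangular formula, net of the gifts and payments it can spoil. *)
Definition big_surplus (a b c d f : nat) : Z :=
  big_share a b - tri_share a b
  - (if a == 2%N then 4620 else 0) - (if b == 2%N then 4620 else 0)
  - (if (b == 0%N) && (c == 0%N) then claim_far d else 0)
  - (if (a == 0%N) && (f == 0%N) then claim_far d else 0).

Definition star_list : seq (5.-tuple (option nat)) :=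
      [:: star 5 5 5 7 17; star 7 5 5 7 11; star 7 5 5 8 9; star 7 5 5 9 8;
          star 7 5 5 11 7; star 5 5 5 8 11; star 8 5 5 9 7; star 8 5 5 11 6;
          star 6 6 6 6 11; star 6 6 6 7 9; star 6 6 7 6 9; star 6 6 7 7 7;
          star 6 7 6 7 7; star 5 6 6 8 9; star 5 6 8 6 9; star 5 6 7 7 9;
          star 5 6 6 7 11; star 5 6 7 6 11; star 5 7 6 7 9; star 5 7 7 6 9;
          star 5 6 6 6 17; star 5 7 6 6 11; star 5 8 6 6 10; star 5 9 6 6 9;
          star 5 5 9 6 9; star_of (Some 5) (Some 6) (Some 6) (Some 5) None;
          star 5 6 7 5 23; star 5 6 8 5 15; star 5 6 9 5 14; star 5 9 5 6 10;
          star 5 8 5 6 11; star 5 7 5 6 17; star 5 7 7 5 11; star 5 7 8 5 9;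
          star 5 8 5 7 9; star 5 7 5 7 11; star 5 7 5 8 10; star 5 7 5 9 9;
          star 5 5 10 5 14; star 5 5 11 5 13]%N.

Definition bound_cls (k : option nat) : nat := if k is Some n then cls n else 12.

Definition star_bounds : seq (seq nat) := Eval vm_compute in
  [seq [seq bound_cls k | k <- val kappa] | kappa <- star_list].

Lemma star_boundsE : star_bounds = [seq [seq bound_cls k | k <- val kappa] | kappa <- star_list].
Proof. by vm_compute. Qed.

Definition fits (c k : seq nat) : bool := all2 leq c k.

Definition hits (c : seq nat) : bool :=
  has (fun k => has (fun r => fits (rot r c) k || fits (rot r c) (seq.rev k)) (iota 0 5))
  star_bounds.

(** For such [n] a class at most [cls n] forces a degree at most [n], so the bounds lose nothing in
    classes. *)
Definition good_bound (k : option nat) : bool :=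
  if k is Some n then n.+1 \in thresholds else true.

Lemma star_list_good : all (fun kappa : 5.-tuple (option nat) => all good_bound kappa) star_list.
Proof. by vm_compute. Qed.

(* Degree classes in cyclic order, the first one maximal; a branch is closed
   as soon as its charge exceeds the largest amount a 5-vertex can ever pay. *)
Definition star_search : bool :=
  all (fun a => if 9240 <=? base_charge a 0 0 0 0 then true else
  all (fun b => if 9240 <=? base_charge a b 0 0 0 then true else
  all (fun c => if 9240 <=? base_charge a b c 0 0 then true else
  all (fun d => if 9240 <=? base_charge a b c d 0 then true else
  all (fun f => if 0 <=? tri_charge a b c d f then true else hits [:: a; b; c; d; f])
    (iota 0 a.+1)) (iota 0 a.+1)) (iota 0 a.+1)) (iota 0 a.+1)) (iota 0 13).

Lemma star_searchT : star_search.
Proof. by vm_cast_no_check (erefl true). Qed.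

Lemma half_gain_itv a : 0 <= half_gain a <= 6930.
Proof. by rewrite /half_gain; do 13 (case: a => [//|a]); rewrite nth_default. Qed.

Lemma claim_far_itv z : 0 <= claim_far z <= 4620.
Proof. by rewrite /claim_far; do 13 (case: z => [//|z]); rewrite nth_default. Qed.

Lemma claim_near_itv u : 0 <= claim_near u <= 4620.
Proof. by rewrite /claim_near; do 5 (case: u => [//|u]); rewrite nth_default. Qed.

Lemma claim_ge0 u z : 0 <= claim u z.
Proof. by rewrite /claim; do 3 (case: ifP => // _). Qed.

Lemma claim_le_far u z : claim u z <= claim_far z.
Proof.
rewrite /claim; have [h _] := claim_far_itv z.
case: ifP => [/andP[_ /eqP ->]//|_]; case: ifP => [/andP[_ /orP[]/eqP ->]//|_].
by case: ifP => [/andP[_ /orP[]/eqP ->]//|_].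
Qed.

Lemma claim_le_near u z : claim u z <= claim_near u.
Proof.
rewrite /claim; have [h _] := claim_near_itv u.
by do 3 (case: ifP => [/andP[/eqP -> _]//|_]).
Qed.

Lemma claim_sym u z : claim u z + claim z u <= 4620.
Proof. by rewrite /claim; do ?case: ifP => ?; lia. Qed.

Lemma claim0l z : claim 0 z = 0. Proof. by []. Qed.
Lemma claim0r u : claim u 0 = 0. Proof. by rewrite /claim !andbF. Qed.

(** The two payments exclude each other, as they need [p2] at least 7 and below 7. *)
Lemma pay_pair p2 p1 c n1 :
  pay_far true p2 p1 c n1 + pay_near n1 c p1 p2 <=
  if [&& c == 0%N, p1 == 0%N & n1 != 0%N] then 4620 else 0.
Proof.
have := claim_far_itv n1; have := claim_near_itv n1.
rewrite /pay_far /pay_near /= leqNgt; have [->|_] := eqVneq n1 0%N; first by do 3 case: ifP.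
case: (c == 0%N); case: (p1 == 0%N); case: (p2 < 7)%N; bsimpl => //; lia.
Qed.

(** By [pay_pair] a payment occurs only at an end of a run of at least two 5-neighbours. Five
    neighbours in a circle leave room for one such run, with two ends. *)
Lemma all_pays_le a b c d f : all_pays a b c d f <= 9240.
Proof.
rewrite /all_pays /pays.
have := @pay_pair d f a b; have := @pay_pair f a b c; have := @pay_pair a b c d.
have := @pay_pair b c d f; have := @pay_pair c d f a; have := @pay_pair c b a f.
have := @pay_pair d c b a; have := @pay_pair f d c b; have := @pay_pair a f d c; have := @pay_pair b a f d.
case: (a == 0%N); case: (b == 0%N); case: (c == 0%N); case: (d == 0%N); case: (f == 0%N); bsimpl; lia.
Qed.

Lemma claims_ge0 p2 p1 c n1 n2 : 0 <= claims p2 p1 c n1 n2.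
Proof.
rewrite /claims /claim_at; have := @claim_ge0 n2 p1; have := @claim_ge0 p2 n1.
by do 2 case: ifP => _; lia.
Qed.

Lemma all_claims_ge0 a b c d f : 0 <= all_claims a b c d f.
Proof.
have := @claims_ge0 d f a b c; have := @claims_ge0 f a b c d; have := @claims_ge0 a b c d f.
have := @claims_ge0 b c d f a; have := @claims_ge0 c d f a b; rewrite /all_claims; lia.
Qed.

(** A nonzero claim determines the positions of [u] and [z] up to reflection, and [claim_sym] bounds
    the two orientations together. Four 5-neighbours exclude a claim; [surplus_ge] needs this when
    both far payments are spoiled. *)
Lemma all_claims_le a b c d f : all_claims a b c d f <=
  if [&& a == 0%N, b == 0%N, c == 0%N & f == 0%N] then 0 else 4620.
Proof.
rewrite /all_claims /claims /claim_at.
have := @claim_sym a c; have := @claim_sym b d; have := @claim_sym c f; have := @claim_sym d a.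
have := @claim_sym f b.
have [->|_] := eqVneq a 0%N; have [->|_] := eqVneq b 0%N; have [->|_] := eqVneq c 0%N;
have [->|_] := eqVneq d 0%N; have [->|_] := eqVneq f 0%N;
  rewrite ?claim0l ?claim0r; bsimpl; lia.
Qed.

Lemma big_part_ge x y : (if (x == 0%N) || (y == 0%N) then 0 else -2310) <=
  big_part x - part x y - (if x == 2%N then 4620 else 0).
Proof.
have [h1 h2] := half_gain_itv x; rewrite /big_part /part.
have [->|nx] := eqVneq x 0%N; first by case: ifP.
have [->|nx2] := eqVneq x 2%N; first by case: (y == 0%N).
by case: (y == 0%N); bsimpl; lia.
Qed.

(** One non-triangular corner makes up for all claims that the star forfeits. Of its 9240, two large
    neighbours cost at most 2310 each, and a far payment at most 4620; two far payments occur only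
    when there is no claim. *)
Lemma surplus_ge a b c d f : all_claims a b c d f <= big_surplus a b c d f.
Proof.
have := @all_claims_le a b c d f; have := @big_part_ge a b; have := @big_part_ge b a.
have [h1 h2] := claim_far_itv d.
rewrite /big_surplus /big_share /tri_share.
case: (a == 0%N); case: (b == 0%N); case: (c == 0%N); case: (f == 0%N); bsimpl; lia.
Qed.

Lemma part_ge0 a b : 0 <= part a b.
Proof. by rewrite /part; have := half_gain_itv a; case: ifP => _; lia. Qed.

Lemma seven_gift_ge0 p a n : 0 <= seven_gift p a n.
Proof. by rewrite /seven_gift; case: ifP. Qed.

Lemma own_term0 p n : own_term p 0 n = 0.
Proof. by rewrite /own_term /part /seven_gift /=; do 2 case: ifP. Qed.

Lemma own_term_ge p a n p' n' : (p' == 0%N) || (p' == p) -> (n' == 0%N) || (n' == n) ->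
  own_term p' a n' <= own_term p a n.
Proof.
have h := half_gain_itv a.
have hp : part a 0 <= part a p by rewrite /part eqxx; case: ifP => _; lia.
have hn : part a 0 <= part a n by rewrite /part eqxx; case: ifP => _; lia.
rewrite /own_term /seven_gift => /orP[/eqP->|/eqP->] /orP[/eqP->|/eqP->]; rewrite ?eqxx;
  case: (a == 2%N); case: (p == 0%N); case: (n == 0%N); bsimpl; lia.
Qed.

Lemma own_term_ge0 p a n : 0 <= own_term p a n.
Proof.
have := @part_ge0 a p; have := @part_ge0 a n; have := @seven_gift_ge0 p a n.
rewrite /own_term; lia.
Qed.

(** This justifies the pruning in [star_search]: filling undecided places with class 0 can only
    lower the charge. *)
Lemma base_charge_prefix a b c d f b' c' d' f' :
  (b' == 0%N) || (b' == b) -> (c' == 0%N) || (c' == c) -> (d' == 0%N) || (d' == d) ->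
  (f' == 0%N) || (f' == f) -> base_charge a b' c' d' f' <= base_charge a b c d f.
Proof.
have aa : (a == 0%N) || (a == a) by rewrite eqxx orbT.
have H p x n p' x' n' : (p' == 0%N) || (p' == p) -> (n' == 0%N) || (n' == n) ->
    (x' == 0%N) || (x' == x) -> own_term p' x' n' <= own_term p x n.
  move=> h1 h2 /orP[/eqP->|/eqP->]; last exact: own_term_ge.
  by rewrite own_term0; exact: own_term_ge0.
move=> hb hc hd hf; rewrite /base_charge.
have := H f a b f' a b' hf hb aa; have := H a b c a b' c' aa hc hb.
have := H b c d b' c' d' hb hd hc; have := H c d f c' d' f' hc hf hd.
have := H d f a d' f' a hd aa hf; lia.
Qed.

Lemma tri_charge_ge a b c d f : 9240 <= base_charge a b c d f -> 0 <= tri_charge a b c d f.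
Proof.
have := @all_pays_le a b c d f; have := @all_claims_ge0 a b c d f.
rewrite /tri_charge; lia.
Qed.

Lemma star_check a b c d f : (a < 13)%N -> (b <= a)%N -> (c <= a)%N -> (d <= a)%N -> (f <= a)%N ->
  tri_charge a b c d f < 0 -> hits [:: a; b; c; d; f].
Proof.
have i m (n : nat) : (n < m)%N -> n \in iota 0 m by rewrite mem_iota.
move=> /(i 13%N) ha /(i a.+1) hb /(i a.+1) hc /(i a.+1) hd /(i a.+1) hf neg.
have nb b' c' d' f' : (b' == 0%N) || (b' == b) -> (c' == 0%N) || (c' == c) ->
   (d' == 0%N) || (d' == d) -> (f' == 0%N) || (f' == f) ->
   (9240 <=? base_charge a b' c' d' f') = false.
  move=> h1 h2 h3 h4; apply/negbTE/negP => /Z.leb_le h.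
  by have := tri_charge_ge (Z.le_trans _ _ _ h (base_charge_prefix h1 h2 h3 h4)); lia.
move: star_searchT => /allP /(_ _ ha); rewrite nb //.
move=> /allP /(_ _ hb); rewrite nb ?eqxx ?orbT //.
move=> /allP /(_ _ hc); rewrite nb ?eqxx ?orbT //.
move=> /allP /(_ _ hd); rewrite nb ?eqxx ?orbT //.
move=> /allP /(_ _ hf); case: Z.leb_spec => //; lia.
Qed.

Lemma cls_le d : (cls d < 13)%N.
Proof. by rewrite ltnS (leq_trans (count_size _ _)). Qed.

Lemma cls_mono d d' : (d <= d')%N -> (cls d <= cls d')%N.
Proof. by move=> h; apply: sub_count => t ht; exact: leq_trans h. Qed.

Lemma bounded_cls d k : good_bound k -> (cls d <= bound_cls k)%N -> bounded_by d k.
Proof.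
case: k => //= n hn h; rewrite leqNgt; apply/negP => /cls_mono h'.
have := leq_trans h' h; apply/negP; rewrite -ltnNge.
by move: hn; rewrite !inE; do 11 (case/orP => [/eqP[->] //|]); move=> /eqP[->].
Qed.

End StarCheck.

(** * Discharging *)

(* [r] is the rotation or its inverse, since deficient stars come in both
   orientations; [c d] is the degree class of the target of [d]. *)
Section Claims.
Local Open Scope Z_scope.
Variables (D : finType) (rev r ri : D -> D) (T : pred D) (c : D -> nat).
Hypothesis revK' : involutive rev.
Hypothesis rK : cancel r ri.
Hypothesis riK : cancel ri r.
Hypothesis c_src : forall d, c (rev (r d)) = c (rev d).
Hypothesis r5 : forall d, c (rev d) = 0%N -> r (r (r (r (r d)))) = d.
Hypothesis tri_tgt : forall d, T d -> c (ri (rev d)) = c (r d).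
Hypothesis tri_rev : forall d, T d -> rev (ri (rev d)) = r (rev (r d)).
Hypothesis tri_next : forall d, T (ri (rev d)) = T d.

(** [T d] stands for a triangle at the corner from [d] to [r d]; only centres of five triangles
    claim. *)
Definition needy d := [&& T d, T (r d), T (r (r d)), T (r (r (r d))) & T (r (r (r (r d))))].

Definition amount d : Z := if (c (rev d) == 0%N) && needy d then
  claim_at (c d) (c (r d)) (c (r (r d))) (c (r (r (r d)))) (c (r (r (r (r d))))) else 0.

(* Whether a claim of the source of [g] is addressed to the target of [g]
   (rather than to the preceding neighbour). *)
Definition addressed g := T (r (rev g)) && (c (r (r (rev g))) < 7)%N.

(** The source of [f] pays its target either as far donor, for the claim recorded at [rev f], or as
    near donor, for the one recorded at [ri (rev f)]. *)
Definition payment f : Z :=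
  (if addressed (r (rev f)) then 0 else amount (rev f)) +
  (if addressed (rev f) then amount (ri (rev f)) else 0).

Lemma amount_ge0 d : 0 <= amount d.
Proof.
rewrite /amount /claim_at; case: ifP => // _; case: ifP => // _; exact: claim_ge0.
Qed.

Lemma c_srcV d : c (rev (ri d)) = c (rev d).
Proof. by rewrite -(c_src (ri d)) riK. Qed.

Lemma amount_neq0 d : amount d <> 0 -> [/\ c (rev d) = 0%N, needy d, c d = 0%N & c (r d) = 0%N] /\
  amount d = claim (c (r (r d))) (c (r (r (r (r d))))).
Proof.
rewrite /amount /claim_at; case: ifP => // /andP[/eqP h1 h2]; case: ifP => // /and3P[/eqP -> /eqP -> _].
by [].
Qed.

Lemma payment0 f : c (rev f) <> 0%N -> payment f = 0.
Proof.
move=> h; rewrite /payment.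
have -> : amount (rev f) = 0.
  by have [//|/eqP/amount_neq0[[_ _ h' _] _]] := eqVneq (amount (rev f)) 0.
have -> : amount (ri (rev f)) = 0.
  have [//|/eqP/amount_neq0[[_ _ _ h'] _]] := eqVneq (amount (ri (rev f))) 0.
  by rewrite riK in h'.
by do 2 case: ifP.
Qed.

Lemma payment_sum : (\sum_f payment f = \sum_d amount d)%R.
Proof.
rewrite big_split /=.
have -> : (\sum_f (if addressed (r (rev f)) then 0 else amount (rev f)) =
          \sum_d (if addressed (r d) then 0 else amount d) :> Z)%R.
  rewrite [RHS](reindex_inj (inv_inj revK')) /=; by [].
have -> : (\sum_f (if addressed (rev f) then amount (ri (rev f)) else 0) =
          \sum_d (if addressed (r d) then amount d else 0) :> Z)%R.
  rewrite [RHS](reindex_inj (inj_comp (can_inj riK) (inv_inj revK'))) /=.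
  by apply: eq_bigr => f _; rewrite riK.
by rewrite -big_split /=; apply: eq_bigr => d _; case: ifP => _; lia.
Qed.

(** The faces at a claimant are triangles, so the other donor and one of [u], [z] are neighbours of
    the donor too. *)
Lemma payment_le f : payment f <=
  pay_far (T (ri (ri f))) (c (ri (ri f))) (c (ri f)) (c f) (c (r f)) +
  pay_near (c (ri f)) (c f) (c (r f)) (c (r (r f))).
Proof.
have far0 a b x y z : 0 <= pay_far a b x y z.
  by rewrite /pay_far; case: ifP => // _; have [] := claim_far_itv z.
have near0 a b x y : 0 <= pay_near a b x y.
  by rewrite /pay_near; case: ifP => // _; have [] := claim_near_itv a.
rewrite /payment; apply: Z.add_le_mono.
- case: ifP => // na; have [->|/eqP/amount_neq0] := eqVneq (amount (rev f)) 0; first exact: far0.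
  rewrite revK' => -[[h1 /and5P[t0 t1 _ _ t4] h2 h3] ->].
  have e1 : c (ri f) = 0%N by have := tri_tgt t0; rewrite revK' h3.
  have r4 : r (r (r (r (rev f)))) = ri (rev f).
    by rewrite -[LHS]rK r5 // revK'.
  rewrite r4 in t4 *.
  have e2 : c (r f) = c (ri (rev f)).
    by have := tri_rev t4; rewrite riK revK' => <-; rewrite c_srcV revK'.
  rewrite /pay_far h1 e1 eqxx e2 /=.
  (* [addressed] looks from the other donor; [x1] and [x2] move its condition to the corner at
     [ri (ri f)] of this one. *)
  have x1 : r (rev (r (rev f))) = rev (ri f) by rewrite -tri_rev ?revK'.
  have x2 : T (rev (ri f)) = T (ri (ri f)) by rewrite -tri_next revK'.
  move: na; rewrite /addressed x1 x2; case tt: (T (ri (ri f))) => /=; last by move=> _; exact: claim_le_far.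
  rewrite -tri_tgt ?x2 // revK' => /negbT; rewrite -leqNgt => ->; exact: claim_le_far.
- case: ifP => // na; have [->|/eqP/amount_neq0] := eqVneq (amount (ri (rev f))) 0; first exact: near0.
  rewrite riK => -[[h1 /and5P[t0 t1 _ _ _] h2 h3] ->]; rewrite riK in t1 *.
  have e1 : c (r f) = 0%N.
    by have := tri_rev t0; rewrite riK revK' => <-; rewrite c_srcV revK'.
  have e2 : c (ri f) = c (r (rev f)) by have := tri_tgt t1; rewrite revK'.
  move: na; rewrite /addressed revK' => /andP[_ na].
  rewrite c_srcV revK' in h1.
  rewrite /pay_near e1 na h1 eqxx /= e2; exact: claim_le_near.
Qed.

End Claims.

Lemma Z_of_card (T : finType) (P : pred T) : Z.of_nat #|P| = (\sum_(x | P x) (1 : Z))%R.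
Proof. by rewrite -sum1_card (big_morph Z.of_nat Nat2Z.inj_add (erefl : Z.of_nat 0%N = 0%R)). Qed.

(** * Charges on a combinatorial map satisfying Euler's inequality *)

Section Discharging.
Local Open Scope Z_scope.
Variables (V D : finType) (src : D -> V) (rev : D -> D) (s : {perm D}).
Hypothesis revK' : involutive rev.
Definition vdeg (v : V) := #|[pred d | src d == v]|.
Hypothesis src_s : forall d, src (s d) = src d.
Hypothesis s_trans : forall d f, src d = src f ->
  exists2 i, (i < vdeg (src d))%N & f = (s ^+ i)%g d.
Hypothesis vdeg_ge5 : forall v, (5 <= vdeg v)%N.
Hypothesis no_loop : forall d, src (rev d) <> src d.
Hypothesis simple : forall d f, src d = src f -> src (rev d) = src (rev f) -> d = f.
Hypothesis rev_inj' : injective rev.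
Hypothesis euler : (#|D| < (#|V| + #|porbits (perm rev_inj' * s^-1)%g|).*2)%N.

Let si : D -> D := (s^-1)%g.
Definition fnext d := si (rev d).
Definition fprev d := rev (s d).
(** The face of [d] is the one at the corner between [d] and [s d]. *)
Definition tri d := fnext (fnext (fnext d)) == d.
Definition tcls d := cls (vdeg (src (rev d))).

Lemma sK' : cancel s si. Proof. exact: permK. Qed.
Lemma siK : cancel si s. Proof. exact: permKV. Qed.

Lemma fnextK : cancel fnext fprev.
Proof. by move=> d; rewrite /fprev /fnext siK revK'. Qed.
Lemma fprevK : cancel fprev fnext.
Proof. by move=> d; rewrite /fprev /fnext revK' sK'. Qed.

Lemma src_si d : src (si d) = src d.
Proof. by rewrite -[RHS](congr1 src (siK d)) src_s. Qed.

Lemma tri_fnext d : tri (fnext d) = tri d.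
Proof. by rewrite /tri (can_eq fnextK). Qed.

Lemma triE d : tri d -> rev (fnext d) = s (rev (s d)).
Proof.
move=> /eqP h; have h2 : fnext (fnext d) = rev (s d).
  by rewrite -[LHS]fnextK h.
by rewrite -h2 /fnext siK.
Qed.

Lemma c_src_s d : tcls (rev (s d)) = tcls (rev d).
Proof. by rewrite /tcls !revK' src_s. Qed.

Lemma c_src_si d : tcls (rev (si d)) = tcls (rev d).
Proof. by rewrite /tcls !revK' src_si. Qed.

Lemma src_sX i d : src ((s ^+ i)%g d) = src d.
Proof. by rewrite permX; elim: i => //= i IH; rewrite src_s. Qed.

Lemma rot_uniq d (ds := [seq (s ^+ i)%g d | i <- iota 0 (vdeg (src d))]) :
  uniq ds /\ ds =i [pred f | src f == src d].
Proof.
have sub : {subset enum [pred f | src f == src d] <= ds}.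
  move=> f; rewrite mem_enum inE => /eqP sf; have [i hi ->] := s_trans (esym sf).
  by apply/mapP; exists i; rewrite // mem_iota.
have sz : size ds = size (enum [pred f | src f == src d]) by rewrite size_map size_iota -cardE.
have u : uniq ds.
  by apply: (leq_size_uniq (enum_uniq _) sub); rewrite sz.
split=> // f; have [_ e] := uniq_min_size (enum_uniq _) sub (eq_leq sz).
by rewrite -e mem_enum.
Qed.

Lemma sum_rot (F : D -> Z) d :
  (\sum_(f | src f == src d) F f = \sum_(i < vdeg (src d)) F ((s ^+ i)%g d))%R.
Proof.
have [u e] := rot_uniq d.
rewrite -(eq_bigl _ _ e) -big_uniq //= big_map -{1}(subn0 (vdeg (src d))) big_mkord.
by [].
Qed.

(** By transitivity the last iterate is among the first ones; an index [j > 0] would close the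
    rotation too early, against [rot_uniq]. *)
Lemma rot_period d : (s ^+ vdeg (src d))%g d = d.
Proof.
have [u _] := rot_uniq d; have n0 : (0 < vdeg (src d))%N by apply: leq_trans (vdeg_ge5 _).
have [j hj e] := s_trans (esym (src_sX (vdeg (src d)) d)).
case: j => [|j] in hj e *; first by rewrite e expg0 perm1.
have e2 : (s ^+ (vdeg (src d) - j.+1))%g d = d.
  apply: (@perm_inj _ (s ^+ j.+1)%g); rewrite -permM -expgD subnK; last exact: ltnW.
  exact: e.
have lt : (vdeg (src d) - j.+1 < vdeg (src d))%N by rewrite ltn_subrL.
have : nth d [seq (s ^+ i)%g d | i <- iota 0 (vdeg (src d))] (vdeg (src d) - j.+1) =
       nth d [seq (s ^+ i)%g d | i <- iota 0 (vdeg (src d))] 0.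
  by rewrite !(nth_map 0%N) ?size_iota // !nth_iota // !add0n e2 expg0 perm1.
move/eqP; rewrite nth_uniq ?size_map ?size_iota // subn_eq0 => h.
by have := leq_ltn_trans h hj; rewrite ltnn.
Qed.

Lemma s_neq d : s d <> d.
Proof.
move=> h; have hX i : (s ^+ i)%g d = d by elim: i => [|i IH]; rewrite ?perm1 // expgSr permM IH.
have [u _] := rot_uniq d; have := vdeg_ge5 (src d); move: u.
case: (vdeg (src d)) => // -[//|n] /=.
by rewrite !hX inE eqxx.
Qed.

Lemma cls0 v : cls (vdeg v) = 0%N -> vdeg v = 5%N.
Proof.
move=> h; apply/eqP; rewrite eqn_leq vdeg_ge5 andbT leqNgt; apply/negP => h6.
by have := cls_mono h6; rewrite h.
Qed.

Lemma s5 d : tcls (rev d) = 0%N -> s (s (s (s (s d)))) = d.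
Proof.
rewrite /tcls revK' => /cls0 h; rewrite -[RHS]rot_period h permX; by [].
Qed.

Lemma si5 d : tcls (rev d) = 0%N -> si (si (si (si (si d)))) = d.
Proof.
move=> h; have h' : tcls (rev (si (si (si (si (si d)))))) = 0%N by rewrite !c_src_si.
by have := s5 h'; rewrite !siK.
Qed.

Lemma c_fnext d : tri d -> tcls (fnext d) = tcls (s d).
Proof. by move=> /triE h; rewrite /tcls h src_s. Qed.

(** [tri] for the mirror image, in which [d] owns the corner between [d] and [si d]. *)
Definition trib d := tri (si d).

Lemma claims_plus_sum : (\sum_f payment rev s si tri tcls f = \sum_d amount rev s tri tcls d)%R.
Proof. apply: payment_sum; [exact: revK'|exact: siK]. Qed.

Lemma claims_minus_sum : (\sum_f payment rev si s trib tcls f = \sum_d amount rev si trib tcls d)%R.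
Proof. apply: payment_sum; [exact: revK'|exact: sK']. Qed.

Lemma pay_plus f : payment rev s si tri tcls f <=
  pay_far (tri (si (si f))) (tcls (si (si f))) (tcls (si f)) (tcls f) (tcls (s f)) +
  pay_near (tcls (si f)) (tcls f) (tcls (s f)) (tcls (s (s f))).
Proof.
apply: payment_le => //; [exact: sK'|exact: siK|exact: c_src_s|exact: s5|exact: c_fnext| |exact: tri_fnext].
by move=> d /triE.
Qed.

Lemma pay_minus f : payment rev si s trib tcls f <=
  pay_far (tri (s f)) (tcls (s (s f))) (tcls (s f)) (tcls f) (tcls (si f)) +
  pay_near (tcls (s f)) (tcls f) (tcls (si f)) (tcls (si (si f))).
Proof.
have E : trib (s (s f)) = tri (s f) by rewrite /trib sK'.
rewrite -E; apply: payment_le => //; [exact: siK|exact: sK'|exact: c_src_si|exact: si5| | |].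
- move=> d td; have := triE td; rewrite siK => <-.
  by rewrite /tcls revK' /fnext src_si.
- move=> d td; have := triE td; rewrite siK => <-.
  by rewrite /fnext revK'.
- by move=> d; rewrite /trib sK' -(tri_fnext (rev d)) /fnext revK'.
Qed.

Definition corner_half d : Z := half_gain (tcls (rev d)) + (if tri d then 0 else 4620).

Definition give_next d : Z :=
  if (tcls (rev d) != 0%N) && (tcls d == 0%N) then
    (if tcls (s d) == 0%N then corner_half d else 2 * corner_half d) else 0.
Definition give_prev d : Z :=
  if (tcls (rev d) != 0%N) && (tcls (s d) == 0%N) then
    (if tcls d == 0%N then corner_half d else 2 * corner_half d) else 0.
Definition gift d : Z :=
  if tcls d == 0%N then seven_gift (tcls (si d)) (tcls (rev d)) (tcls (s d)) else 0.
Definition excess d : Z := if tri d then 0 else 9240.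
(** [fprev d] and [fnext d] lie on the face of [d] and start at the two neighbours bounding its
    corner. *)
Definition incoming d : Z := give_next (fprev d) + give_prev (fnext d).

Definition gain d : Z := excess d + incoming d + gift (rev d)
  + amount rev s tri tcls d + amount rev si trib tcls d.
Definition loss d : Z := give_next d + give_prev d + gift d
  + payment rev s si tri tcls d + payment rev si s trib tcls d.

Definition weight (v : V) : Z :=
  18480 * (Z.of_nat (vdeg v) - 6) + (\sum_(d | src d == v) (gain d - loss d))%R.

(** Every transfer is once a gain and once a loss, so only the vertex charges and the contribution
    of the faces remain. *)
Lemma weight_sum : (\sum_v weight v)%R =
  18480 * (Z.of_nat #|D|) - 6 * 18480 * Z.of_nat #|V| + (\sum_d excess d)%R.
Proof.
have sumV (F : D -> Z) : (\sum_v \sum_(d | src d == v) F d = \sum_d F d)%R.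
  by rewrite [RHS](partition_big src xpredT).
pose w0 v := 18480 * (Z.of_nat (vdeg v) - 6).
have -> : (\sum_v weight v = \sum_v w0 v + \sum_d (gain d - loss d))%R.
  by rewrite -sumV -big_split.
have -> : (\sum_d (gain d - loss d) = \sum_d gain d - \sum_d loss d)%R by rewrite sumrB.
have -> : (\sum_d gain d = \sum_d excess d + \sum_d loss d)%R.
  have sum5 (f1 f2 f3 f4 f5 : D -> Z) : (\sum_d (f1 d + f2 d + f3 d + f4 d + f5 d) =
     \sum_d f1 d + \sum_d f2 d + \sum_d f3 d + \sum_d f4 d + \sum_d f5 d)%R.
    by rewrite !big_split.
  have -> : (\sum_d gain d = \sum_d excess d + \sum_d incoming d + \sum_d gift (rev d)
    + \sum_d amount rev s tri tcls d + \sum_d amount rev si trib tcls d)%R by exact: sum5.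
  have -> : (\sum_d loss d = \sum_d give_next d + \sum_d give_prev d + \sum_d gift d
    + \sum_d payment rev s si tri tcls d + \sum_d payment rev si s trib tcls d)%R by exact: sum5.
  have -> : (\sum_d incoming d = \sum_d give_next (fprev d) + \sum_d give_prev (fnext d))%R.
    by rewrite -big_split.
  rewrite claims_plus_sum claims_minus_sum.
  have -> : (\sum_d gift (rev d) = \sum_d gift d)%R by rewrite [RHS](reindex_inj rev_inj').
  have -> : (\sum_d give_next (fprev d) = \sum_d give_next d)%R.
    by rewrite [RHS](reindex_inj (can_inj fprevK)).
  have -> : (\sum_d give_prev (fnext d) = \sum_d give_prev d)%R.
    by rewrite [RHS](reindex_inj (can_inj fnextK)).
  lia.
have cV : (\sum_v (Z.of_nat (vdeg v)) = Z.of_nat #|D| :> Z)%R.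
  rewrite Z_of_card -(sumV (fun=> 1)); apply: eq_bigr => v _.
  by rewrite /vdeg Z_of_card; apply: eq_bigl => d; rewrite inE.
have c1 : (\sum_(v : V) (1 : Z))%R = Z.of_nat #|V| by rewrite Z_of_card.
have -> : (\sum_v w0 v)%R = 18480 * (\sum_v Z.of_nat (vdeg v))%R - 110880 * (\sum_(v : V) (1 : Z))%R.
  by apply: (big_rec3 (fun x y z : Z => x = 18480 * y - 110880 * z)) => // v x y z _; rewrite /w0; lia.
rewrite cV c1; lia.
Qed.


Lemma sumZ_le (I : Type) (r : seq I) (P : pred I) (F G : I -> Z) :
  (forall i, P i -> F i <= G i) -> (\sum_(i <- r | P i) F i)%R <= (\sum_(i <- r | P i) G i)%R.
Proof. by move=> h; elim/big_rec2: _ => // i x y Pi; have := h i Pi; lia. Qed.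

Let face : {perm D} := (perm rev_inj' * s^-1)%g.

Lemma faceE d : face d = fnext d.
Proof. by rewrite /face permM (permE rev_inj'). Qed.

(** Length 1 would be a loop. For length 2, simplicity makes the two darts reverses of each other,
    and [s] would fix one of them. *)
Lemma card_face_ge3 d : (3 <= #|porbit face d|)%N.
Proof.
have ne x : fnext x <> x.
  by move=> h; apply: (@no_loop x); rewrite -[in RHS]h /fnext src_si.
have ne2 x : fnext (fnext x) <> x.
  move=> h; have h2 : fnext x = rev x.
    by apply: simple; [exact: src_si|rewrite revK' -[in RHS]h [in RHS]/fnext src_si].
  by apply: (@s_neq (rev x)); rewrite -[in LHS]h2 /fnext siK.
have u : uniq [:: d; fnext d; fnext (fnext d)].
  have /eqP/negbTE h1 := ne d; have /eqP/negbTE h2 := ne (fnext d); have /eqP/negbTE h3 := ne2 d.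
  by rewrite /= !inE ![d == _]eq_sym h1 h3 [fnext d == _]eq_sym h2.
rewrite cardE; apply: (uniq_leq_size u) => x.
rewrite mem_enum !inE => /or3P[] /eqP ->.
- exact: porbit_id.
- by rewrite -faceE (mem_porbit face 1).
- by rewrite -!faceE; have := mem_porbit face 2 d; rewrite permX.
Qed.

(** A face of length [k] owns [36960 (k - 3)] and spends at most [9240 k] if [k >= 4], with equality
    of the two at 4, and nothing if [k = 3]. *)
Lemma excess_sum : (\sum_d excess d)%R <=
  36960 * Z.of_nat #|D| - 110880 * Z.of_nat #|porbits face|.
Proof.
pose n (A : {set D}) : Z := (\sum_(d | porbit face d == A) (1 : Z))%R.
have part (F : D -> Z) : (\sum_d F d =
    \sum_(A in porbits face) \sum_(d | porbit face d == A) F d)%R.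
  by rewrite (partition_big (porbit face) (mem (porbits face))) // => d _; exact: imset_f.
have nE d : n (porbit face d) = Z.of_nat #|porbit face d|.
  by rewrite Z_of_card; apply: eq_bigl => x; rewrite eq_porbit_mem.
have e1 : (\sum_(A in porbits face) n A)%R = Z.of_nat #|D| by rewrite Z_of_card -part.
have e2 : (\sum_(A in porbits face) (1 : Z))%R = Z.of_nat #|porbits face| by rewrite Z_of_card.
pose q A := 36960 * n A - 110880.
pose cst (d : D) : Z := 9240.
have h : (\sum_(A in porbits face) \sum_(d | porbit face d == A) excess d)%R <=
         (\sum_(A in porbits face) q A)%R.
  apply: sumZ_le => _ /imsetP[d0 _ ->]; rewrite /q nE.
  have := card_face_ge3 d0; rewrite leq_eqVlt => /predU1P[k3|k4].
    rewrite big1; first by rewrite -k3.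
    move=> d /eqP hd; rewrite /excess; case: ifP => // /negP[]; apply/eqP.
    have := iter_porbit face d; rewrite hd -k3 /= !faceE; by [].
  have : (\sum_(d | porbit face d == porbit face d0) excess d)%R <=
         (\sum_(d | porbit face d == porbit face d0) cst d)%R.
    by apply: sumZ_le => d _; rewrite /excess; case: ifP.
  have -> : (\sum_(d | porbit face d == porbit face d0) cst d)%R = 9240 * n (porbit face d0).
    by apply: (big_rec2 (fun x y : Z => x = 9240 * y)) => // d x y _; rewrite /cst; lia.
  rewrite nE; lia.
rewrite part; apply: Z.le_trans h _.
have -> : (\sum_(A in porbits face) q A)%R =
   36960 * (\sum_(A in porbits face) n A)%R - 110880 * (\sum_(A in porbits face) (1 : Z))%R.
  by apply: (big_rec3 (fun x y z : Z => x = 36960 * y - 110880 * z)) => // A x y z _; rewrite /q; lia.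
rewrite e1 e2; lia.
Qed.

Lemma negative_weight : exists v, weight v < 0.
Proof.
apply: contrapT => h; have h0 v : 0 <= weight v.
  by have [//|h'] := Z.le_gt_cases 0 (weight v); case: h; exists v.
have : (\sum_(v : V) (fun=> 0) v)%R <= (\sum_v weight v)%R by apply: sumZ_le.
rewrite weight_sum big1 //; have := excess_sum; have := euler; rewrite -/face; lia.
Qed.

Lemma give_next_ge0 d : 0 <= give_next d.
Proof.
rewrite /give_next /corner_half; have [? _] := half_gain_itv (tcls (rev d)).
by do ?case: ifP => _; lia.
Qed.

Lemma give_prev_ge0 d : 0 <= give_prev d.
Proof.
rewrite /give_prev /corner_half; have [? _] := half_gain_itv (tcls (rev d)).
by do ?case: ifP => _; lia.
Qed.

Lemma gift_ge0 d : 0 <= gift d.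
Proof. by rewrite /gift; case: ifP => // _; exact: seven_gift_ge0. Qed.

Lemma gain_ge d : excess d <= gain d.
Proof.
have := @give_next_ge0 (fprev d); have := @give_prev_ge0 (fnext d); have := @gift_ge0 (rev d).
have := @amount_ge0 _ rev s tri tcls d; have := @amount_ge0 _ rev si trib tcls d.
rewrite /gain /incoming; lia.
Qed.

Lemma loss_le d : tcls (rev d) <> 0%N ->
  loss d <= 2 * half_gain (tcls (rev d)) + excess d + gift d.
Proof.
move=> h; rewrite /loss.
rewrite (payment0 tri siK h) (payment0 trib sK' h).
have [? _] := half_gain_itv (tcls (rev d)).
rewrite /give_next /give_prev /corner_half /excess; move/eqP: h => ->.
by case: (tcls d == 0%N); case: (tcls (s d) == 0%N); case: (tri d); bsimpl; lia.
Qed.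

(** For the least degree [d <= n] of the class, [n (1 - 6/d) <= n - 6]. Degrees below 24 are tried
    in turn; from 24 on the share is 3/4. *)
Lemma gain_bound n : (8 <= n)%N ->
  Z.of_nat n * (2 * half_gain (cls n)) <= 18480 * (Z.of_nat n - 6).
Proof.
move=> n8; have [n24|n24] := ltnP n 24.
  by move: n8; do 24 (case: n n24 => [//|n] n24).
have -> : cls n = 12%N.
  by apply/eqP; rewrite eqn_leq -ltnS cls_le /=; exact: (cls_mono n24).
rewrite (_ : half_gain 12 = 6930) //; lia.
Qed.

Lemma dart_at v : exists d, src d = v.
Proof.
have : (0 < vdeg v)%N by apply: leq_trans (vdeg_ge5 v).
by case/card_gt0P => d; rewrite inE => /eqP; exists d.
Qed.

(** The charge 1 pays for four gifts. With [k] neighbours of degree above 5, at most [2 k] and at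
    most [7 - k] neighbours receive one, hence at most 4. *)
Lemma gift_sum7 v : vdeg v = 7%N -> (\sum_(d | src d == v) gift d)%R <= 18480.
Proof.
move=> v7; have [d dv] := dart_at v.
have per : s (s (s (s (s (s (s d)))))) = d by rewrite -[RHS]rot_period dv v7 permX.
rewrite -dv sum_rot dv v7 !big_ord_recl big_ord0 /= !permX /=.
have gl x : gift x <= if (tcls x == 0%N) && ~~ ((tcls (si x) == 0%N) && (tcls (s x) == 0%N)) then 4620 else 0.
  by rewrite /gift /seven_gift; case: (tcls x == 0%N) => //=; case: (tcls (rev x) == 2%N) => //=; case: ifP.
have g0 := gl d; have g1 := gl (s d); have g2 := gl (s (s d)); have g3 := gl (s (s (s d))).
have g4 := gl (s (s (s (s d)))); have g5 := gl (s (s (s (s (s d))))).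
have g6 := gl (s (s (s (s (s (s d)))))).
have sd : si d = s (s (s (s (s (s d))))) by rewrite -{1}per sK'.
rewrite per in g6; rewrite sd in g0; rewrite !sK' in g1 g2 g3 g4 g5 g6.
move: g0 g1 g2 g3 g4 g5 g6.
case: (tcls d == 0%N); case: (tcls (s d) == 0%N); case: (tcls (s (s d)) == 0%N);
case: (tcls (s (s (s d))) == 0%N); case: (tcls (s (s (s (s d)))) == 0%N);
case: (tcls (s (s (s (s (s d))))) == 0%N); case: (tcls (s (s (s (s (s (s d)))))) == 0%N);
bsimpl; lia.
Qed.

Lemma weight_ge6 v : (6 <= vdeg v)%N -> 0 <= weight v.
Proof.
move=> v6; pose k := cls (vdeg v).
have k0 : k <> 0%N by have := cls_mono v6; rewrite -/k => h h'; rewrite h' in h.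
have cv d : src d = v -> tcls (rev d) = k by move=> dv; rewrite /tcls revK' dv.
pose low d := - (2 * half_gain k) - gift d.
have h : (\sum_(d | src d == v) low d)%R <=
  (\sum_(d | src d == v) (gain d - loss d))%R.
  apply: sumZ_le => d /eqP /cv dv; have := @gain_ge d; rewrite /low.
  by have := @loss_le d; rewrite dv => /(_ k0); lia.
have e1 : (\sum_(d | src d == v) (1 : Z))%R = Z.of_nat (vdeg v).
  by rewrite Z_of_card; apply: eq_bigl => d; rewrite inE.
have e2 : (\sum_(d | src d == v) low d)%R =
   - (2 * half_gain k) * (\sum_(d | src d == v) (1 : Z))%R - (\sum_(d | src d == v) gift d)%R.
  by apply: (big_rec3 (fun x y z : Z => x = - (2 * half_gain k) * y - z)) => [|d x y z _]; rewrite /low; lia.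
rewrite e2 e1 in h; rewrite /weight.
have [v8|v8] := leqP 8 (vdeg v).
  have g0 : (\sum_(d | src d == v) gift d)%R = 0.
    apply: big1 => d /eqP /cv dv; rewrite /gift /seven_gift dv.
    have : (2 < k)%N by exact: (cls_mono v8).
    by case: ltngtP => // ?; case: ifP.
  have := @gain_bound _ v8; rewrite -/k; lia.
have [v7|v7] : vdeg v = 6%N \/ vdeg v = 7%N by lia.
  have k1 : k = 1%N by rewrite /k v7.
  have g0 : (\sum_(d | src d == v) gift d)%R = 0.
    by apply: big1 => d /eqP /cv dv; rewrite /gift /seven_gift dv k1; case: ifP.
  rewrite (_ : half_gain k = 0) ?k1 // in h; lia.
have k2 : k = 2%N by rewrite /k v7.
have := @gift_sum7 v v7; rewrite (_ : half_gain k = 0) ?k2 // in h; lia.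
Qed.

Lemma c_rev_fnext d : tcls (rev (fnext d)) = tcls d.
Proof. by rewrite /tcls revK' /fnext src_si. Qed.

Lemma c_s_rev d : tri (si d) -> tcls (s (rev d)) = tcls (si d).
Proof. by move=> /triE; rewrite siK => <-; rewrite c_rev_fnext. Qed.

Lemma share_ge d : tcls (rev d) = 0%N ->
  (if tri d then tri_share (tcls d) (tcls (s d)) else big_share (tcls d) (tcls (s d))) <= excess d + incoming d.
Proof.
move=> cd; rewrite /incoming /give_next /give_prev /corner_half.
rewrite -(tri_fnext (fprev d)) fprevK tri_fnext c_rev_fnext.
have e1 : tcls (rev (fprev d)) = tcls (s d) by rewrite /fprev revK'.
have e2 : tcls (fprev d) = 0%N by rewrite /fprev c_src_s.
have e3 : tcls (s (fnext d)) = 0%N by rewrite /fnext siK.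
have e4 : tri d -> tcls (s (fprev d)) = tcls d by move=> /triE h; rewrite /fprev -h c_rev_fnext.
have e5 : tri d -> tcls (fnext d) = tcls (s d) by exact: c_fnext.
rewrite e1 e2 e3 eqxx !andbT /excess; move: e4 e5.
have [h1 _] := half_gain_itv (tcls d); have [h2 _] := half_gain_itv (tcls (s d)).
have z x : x == 0%N -> half_gain x = 0 by move/eqP ->.
case: (tri d) => [/(_ isT) -> /(_ isT) ->|_ _].
  rewrite /tri_share /part; have := z (tcls d); have := z (tcls (s d)).
  case: (tcls d == 0%N); case: (tcls (s d) == 0%N); bsimpl; move=> z1 z2;
    rewrite ?(z1 isT) ?(z2 isT); lia.
rewrite /big_share /big_part.
case: (tcls d == 0%N); case: (tcls (s d) == 0%N); case: (tcls (s (fprev d)) == 0%N);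
  case: (tcls (fnext d) == 0%N); bsimpl; lia.
Qed.

Definition seven_loss (a : nat) : Z := if a == 2%N then 4620 else 0.

(** Across a triangle, the vertex flanking the centre around the 7-vertex is the one flanking the
    7-vertex around the centre; any other corner may cost the gift. *)
Lemma gift_rev_ge d : tcls (rev d) = 0%N ->
  seven_gift (tcls (si d)) (tcls d) (tcls (s d)) - (if tri d then 0 else seven_loss (tcls d))
   - (if tri (si d) then 0 else seven_loss (tcls d)) <= gift (rev d).
Proof.
move=> cd; have := @gift_ge0 (rev d).
rewrite /gift cd eqxx revK'.
have -> : si (rev d) = fnext d by [].
have le p a n : seven_gift p a n <= seven_loss a.
  by rewrite /seven_gift /seven_loss; case: (a == 2%N); case: (p == 0%N); case: (n == 0%N); bsimpl; lia.
have sym p a n : seven_gift p a n = seven_gift n a p.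
  by rewrite /seven_gift [(n == 0%N) && _]andbC.
have l0 : 0 <= seven_loss (tcls d) by rewrite /seven_loss; case: ifP.
have := le (tcls (si d)) (tcls d) (tcls (s d)).
case t0: (tri d); case t1: (tri (si d)); try lia.
by rewrite c_fnext // c_s_rev // [X in _ -> _ -> _ <= X]sym; lia.
Qed.

Definition far_loss (a p n : nat) : Z := if (a == 0%N) && (p == 0%N) then claim_far n else 0.

Lemma pay_far_le t p2 p1 a n :
  pay_far t p2 p1 a n <= pay_far true p2 p1 a n + (if t then 0 else far_loss a p1 n).
Proof.
rewrite /pay_far /far_loss; have [h _] := claim_far_itv n.
case: t; case: (a == 0%N); case: (p1 == 0%N); case: (7 <= p2)%N; bsimpl; lia.
Qed.

(** The flags say whether the corners of [d], [si d], [si (si d)] and [s d] are triangular, the only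
    ones that affect the bound at [d]. *)
Definition net_low (t t_1 t_2 t1 : bool) (p2 p1 a n1 n2 : nat) (A : Z) : Z :=
  tri_share a n1 + seven_gift p1 a n1 - pays true true p2 p1 a n1 n2 + A
  + (if t then 0 else big_share a n1 - tri_share a n1 - seven_loss a)
  - (if t_1 then 0 else seven_loss a)
  - (if t_2 then 0 else far_loss a p1 n1) - (if t1 then 0 else far_loss a n1 p1).

Lemma net_ge d : tcls (rev d) = 0%N ->
  net_low (tri d) (tri (si d)) (tri (si (si d))) (tri (s d))
    (tcls (si (si d))) (tcls (si d)) (tcls d) (tcls (s d)) (tcls (s (s d)))
    (amount rev s tri tcls d + amount rev si trib tcls d) <= gain d - loss d.
Proof.
move=> cd; have := share_ge cd; have := gift_rev_ge cd; have := @pay_plus d; have := @pay_minus d.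
have := @pay_far_le (tri (si (si d))) (tcls (si (si d))) (tcls (si d)) (tcls d) (tcls (s d)).
have := @pay_far_le (tri (s d)) (tcls (s (s d))) (tcls (s d)) (tcls d) (tcls (si d)).
have gn : give_next d = 0 by rewrite /give_next cd.
have gp : give_prev d = 0 by rewrite /give_prev cd.
have gg : gift d = 0 by rewrite /gift /seven_gift cd; case: ifP.
rewrite /net_low /gain /loss /pays gn gp gg; case: (tri d); lia.
Qed.

Lemma amount_tri d : tcls (rev d) = 0%N -> tri d -> tri (s d) -> tri (s (s d)) ->
  tri (s (s (s d))) -> tri (s (s (s (s d)))) ->
  amount rev s tri tcls d + amount rev si trib tcls d =
  claims (tcls (s (s (s d)))) (tcls (s (s (s (s d))))) (tcls d) (tcls (s d)) (tcls (s (s d))).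
Proof.
move=> cd t0 t1 t2 t3 t4; have per := s5 cd.
have e : si d = s (s (s (s d))) by rewrite -{1}per sK'.
rewrite /amount /needy /trib cd eqxx t0 t1 t2 t3 t4 !e !sK' t0 t1 t2 t3 t4 /=.
by rewrite /claims.
Qed.

Lemma big_surplusE a b x y z : big_surplus a b x y z = big_share a b - tri_share a b
  - seven_loss a - seven_loss b - far_loss x b y - far_loss z a y.
Proof.
by rewrite /big_surplus /far_loss [(x == 0%N) && _]andbC [(z == 0%N) && _]andbC.
Qed.

(** With five triangles the formula is exact. Otherwise the claims may be lost, but every
    non-triangular corner has a nonnegative surplus, and one alone replaces them by [surplus_ge]. *)
Lemma assemble (t0 t1 t2 t3 t4 : bool) (k0 k1 k2 k3 k4 : nat) (A0 A1 A2 A3 A4 : Z) :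
  0 <= A0 -> 0 <= A1 -> 0 <= A2 -> 0 <= A3 -> 0 <= A4 ->
  ([&& t0, t1, t2, t3 & t4] -> A0 + A1 + A2 + A3 + A4 = all_claims k0 k1 k2 k3 k4) ->
  tri_charge k0 k1 k2 k3 k4 <= net_low t0 t4 t3 t1 k3 k4 k0 k1 k2 A0
   + net_low t1 t0 t4 t2 k4 k0 k1 k2 k3 A1 + net_low t2 t1 t0 t3 k0 k1 k2 k3 k4 A2
   + net_low t3 t2 t1 t4 k1 k2 k3 k4 k0 A3 + net_low t4 t3 t2 t0 k2 k3 k4 k0 k1 A4 - 18480.
Proof.
move=> h0 h1 h2 h3 h4.
have cyc a b x y z : all_claims b x y z a = all_claims a b x y z by rewrite /all_claims; lia.
have s0 := @surplus_ge k0 k1 k2 k3 k4; have s1 := @surplus_ge k1 k2 k3 k4 k0.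
have s2 := @surplus_ge k2 k3 k4 k0 k1; have s3 := @surplus_ge k3 k4 k0 k1 k2.
have s4 := @surplus_ge k4 k0 k1 k2 k3; have c0 := @all_claims_ge0 k0 k1 k2 k3 k4.
rewrite (cyc k0 k1 k2 k3 k4) in s1; rewrite (cyc k1 k2 k3 k4 k0) (cyc k0 k1 k2 k3 k4) in s2.
rewrite -(cyc k3 k4 k0 k1 k2) -(cyc k4 k0 k1 k2 k3) in s3; rewrite -(cyc k4 k0 k1 k2 k3) in s4.
rewrite !big_surplusE in s0 s1 s2 s3 s4.
have e : tri_charge k0 k1 k2 k3 k4 = tri_share k0 k1 + tri_share k1 k2 + tri_share k2 k3 + tri_share k3 k4
   + tri_share k4 k0 + seven_gift k4 k0 k1 + seven_gift k0 k1 k2 + seven_gift k1 k2 k3 + seven_gift k2 k3 k4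
   + seven_gift k3 k4 k0 - 18480 + all_claims k0 k1 k2 k3 k4 - all_pays k0 k1 k2 k3 k4.
  by rewrite /tri_charge /base_charge /own_term /tri_share; lia.
rewrite e /all_pays /net_low => hA; clear e cyc.
have [/hA|/negP nt] := boolP [&& t0, t1, t2, t3 & t4].
  case: t0 {hA}; case: t1; case: t2; case: t3; case: t4; lia.
clear hA; move: nt; case: t0; case: t1; case: t2; case: t3; case: t4; bsimpl => nt; lia.
Qed.

Lemma weight_ge v d : vdeg v = 5%N -> src d = v ->
  tri_charge (tcls d) (tcls (s d)) (tcls (s (s d))) (tcls (s (s (s d)))) (tcls (s (s (s (s d))))) <= weight v.
Proof.
move=> v5 dv.
have c0 : tcls (rev d) = 0%N by rewrite /tcls revK' dv v5.
have c1 : tcls (rev (s d)) = 0%N by rewrite c_src_s.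
have c2 : tcls (rev (s (s d))) = 0%N by rewrite c_src_s.
have c3 : tcls (rev (s (s (s d)))) = 0%N by rewrite c_src_s.
have c4 : tcls (rev (s (s (s (s d))))) = 0%N by rewrite c_src_s.
have per := s5 c0; have e : si d = s (s (s (s d))) by rewrite -{1}per sK'.
have n0 := net_ge c0; have n1 := net_ge c1; have n2 := net_ge c2; have n3 := net_ge c3; have n4 := net_ge c4.
have a0 := amount_tri c0; have a1 := amount_tri c1; have a2 := amount_tri c2.
have a3 := amount_tri c3; have a4 := amount_tri c4.
rewrite !per in a1 a2 a3 a4.
rewrite !e !sK' in n0; rewrite !sK' !e in n1; rewrite !sK' in n2; rewrite !sK' ?per in n3.
rewrite !sK' !per in n4.
have pos x : 0 <= amount rev s tri tcls x + amount rev si trib tcls x.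
  by apply: Z.add_nonneg_nonneg; exact: amount_ge0.
have W : weight v = 18480 * (5 - 6) + ((gain d - loss d) + ((gain (s d) - loss (s d)) +
   ((gain (s (s d)) - loss (s (s d))) + ((gain (s (s (s d))) - loss (s (s (s d)))) +
   ((gain (s (s (s (s d)))) - loss (s (s (s (s d))))) + 0))))).
  rewrite /weight v5 -dv sum_rot dv v5 !big_ord_recl big_ord0 !permX; reflexivity.
have := assemble (pos d) (pos (s d)) (pos (s (s d))) (pos (s (s (s d)))) (pos (s (s (s (s d))))).
move=> /(_ (tri d) (tri (s d)) (tri (s (s d))) (tri (s (s (s d)))) (tri (s (s (s (s d)))))).
move=> /(_ (tcls d) (tcls (s d)) (tcls (s (s d))) (tcls (s (s (s d)))) (tcls (s (s (s (s d)))))) H.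
have {}H := H _; rewrite W.
suff h : [&& tri d, tri (s d), tri (s (s d)), tri (s (s (s d))) & tri (s (s (s (s d))))] ->
  amount rev s tri tcls d + amount rev si trib tcls d
  + (amount rev s tri tcls (s d) + amount rev si trib tcls (s d))
  + (amount rev s tri tcls (s (s d)) + amount rev si trib tcls (s (s d)))
  + (amount rev s tri tcls (s (s (s d))) + amount rev si trib tcls (s (s (s d))))
  + (amount rev s tri tcls (s (s (s (s d)))) + amount rev si trib tcls (s (s (s (s d))))) =
  all_claims (tcls d) (tcls (s d)) (tcls (s (s d))) (tcls (s (s (s d)))) (tcls (s (s (s (s d))))).
  by have := H h; lia.
move=> /and5P[t0 t1 t2 t3 t4]; rewrite a0 // a1 // a2 // a3 // a4 //.
Qed.

Theorem star_exists : exists d, [/\ vdeg (src d) = 5%N, (forall i, tcls ((s ^+ i)%g d) <= tcls d)%N &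
  hits [:: tcls d; tcls (s d); tcls (s (s d)); tcls (s (s (s d))); tcls (s (s (s (s d))))]].
Proof.
have [v wv] := negative_weight.
have v5 : vdeg v = 5%N.
  apply/eqP; rewrite eqn_leq vdeg_ge5 andbT leqNgt; apply/negP => /weight_ge6; lia.
have [d0 dv0] := dart_at v.
(* Starting at a neighbour of maximal class matches the normal form of [star_check]. *)
have [d /eqP dv dmax] := @arg_maxnP _ d0 (fun d => src d == v) tcls (introT eqP dv0).
have mx i : (tcls ((s ^+ i)%g d) <= tcls d)%N by apply: dmax; rewrite src_sX dv.
exists d; split => //; first by rewrite dv.
have := @weight_ge v d v5 dv => h.
have m1 := mx 1%N; have m2 := mx 2%N; have m3 := mx 3%N; have m4 := mx 4%N.
rewrite !permX /= in m1 m2 m3 m4.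
apply: star_check => //; first exact: cls_le.
lia.
Qed.

End Discharging.

(** * From classes back to degrees and stars of the embedding *)

Lemma all2_leq_nth (tcls k : seq nat) i : all2 leq tcls k -> (i < size tcls)%N ->
  (nth 0%N tcls i <= nth 0%N k i)%N.
Proof.
by elim: tcls k i => [|x tcls IH] [|y k] [|i] //= /andP[xy h] hi; [|exact: IH].
Qed.

Theorem theorem12 (R : realType) (V : finType) (e : rel V)
    (e_sym : symmetric e) (e_irrefl : irreflexive e)
    (G : plane_embedding R e) (e_mindeg : min_degree_eq e 5) :
  exists kappa : 5.-tuple (option nat),
    kappa \in
      [:: star 5 5 5 7 17; star 7 5 5 7 11; star 7 5 5 8 9; star 7 5 5 9 8;
          star 7 5 5 11 7; star 5 5 5 8 11; star 8 5 5 9 7; star 8 5 5 11 6;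
          star 6 6 6 6 11; star 6 6 6 7 9; star 6 6 7 6 9; star 6 6 7 7 7;
          star 6 7 6 7 7; star 5 6 6 8 9; star 5 6 8 6 9; star 5 6 7 7 9;
          star 5 6 6 7 11; star 5 6 7 6 11; star 5 7 6 7 9; star 5 7 7 6 9;
          star 5 6 6 6 17; star 5 7 6 6 11; star 5 8 6 6 10; star 5 9 6 6 9;
          star 5 5 9 6 9; star_of (Some 5) (Some 6) (Some 6) (Some 5) None;
          star 5 6 7 5 23; star 5 6 8 5 15; star 5 6 9 5 14; star 5 9 5 6 10;
          star 5 8 5 6 11; star 5 7 5 6 17; star 5 7 7 5 11; star 5 7 8 5 9;
          star 5 8 5 7 9; star 5 7 5 7 11; star 5 7 5 8 10; star 5 7 5 9 9;
          star 5 5 10 5 14; star 5 5 11 5 13]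
    /\ has_star G kappa.
Proof.
have [s [src_s s_trans euler ccw]] := plane_rotation e_sym e_irrefl G.
have vE v : vdeg (@src V e) v = degree e v.
  (* Any angle function serves here: only the set of darts at [v] matters. *)
  rewrite -(size_darts_at (fun=> 0%R : R)) -(card_uniqP (darts_at_uniq _ v)).
  by apply: eq_card => d; rewrite mem_darts_at inE.
have [d0] : exists d0 : dart e, True.
  have [_ [v]] := e_mindeg; rewrite /degree => hv.
  have : (0 < #|[pred w | e v w]|)%N by rewrite hv.
  by case/card_gt0P => w; rewrite inE => vw; exists (exist _ (v, w) vw).
move=> _; have D0 : (0 < #|{: dart e}|)%N by apply/card_gt0P; exists d0.
have tr d f : src d = src f -> exists2 i, (i < vdeg (@src V e) (src d))%N & f = (s ^+ i)%g d.
  by rewrite vE; exact: s_trans.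
have ge5 v : (5 <= vdeg (@src V e) v)%N by rewrite vE; have [] := e_mindeg.
have nl (d : dart e) : src (flip e_sym d) <> src d.
  by rewrite src_rev; apply/nesym; exact: (edge_neq e_irrefl (dartP d)).
have sm (d f : dart e) : src d = src f -> src (flip e_sym d) = src (flip e_sym f) -> d = f.
  by rewrite !src_rev; exact: dart_inj.
have [d [d5 _ hit]] := star_exists (revK e_sym) src_s tr ge5 nl sm (euler D0).
have per : s (s (s (s (s d)))) = d.
  by have := rot_period src_s tr ge5 d; rewrite d5 permX.
move: hit; rewrite /hits star_boundsE has_map => /hasP[kappa hk hit].
pose cs := [:: tcls (@src V e) (flip e_sym) d; tcls (@src V e) (flip e_sym) (s d);
    tcls (@src V e) (flip e_sym) (s (s d)); tcls (@src V e) (flip e_sym) (s (s (s d)));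
    tcls (@src V e) (flip e_sym) (s (s (s (s d))))].
have /hasP[r hr fit] : has (fun r => fits (rot r cs) [seq bound_cls k | k <- kappa]
    || fits (rot r cs) (seq.rev [seq bound_cls k | k <- kappa])) (iota 0 5) by exact: hit.
exists kappa; split; first exact: hk.
pose d' := (s ^+ r)%g d.
have sd' : src d' = src d by exact: (src_sX src_s).
have d5' : degree e (src d') = 5%N by rewrite sd' -vE.
have rotE : rot r cs =
  [seq cls (degree e (tgt ((s ^+ i)%g d'))) | i <- iota 0 5].
  move: hr; rewrite /d' /cs /tcls mem_iota /=.
  by case: r {fit d' sd' d5' hit} => [|[|[|[|[|//]]]]] _; rewrite /rot /= !permX /= ?per !vE.
rewrite {}rotE in fit.
have good i : good_bound (tnth kappa i).
  have /allP h := allP star_list_good _ hk.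
  by apply: h; exact: mem_tnth.
have bE (i : 'I_5) : nth 0%N [seq bound_cls k | k <- kappa] i = bound_cls (tnth kappa i).
  by rewrite (nth_map None) ?size_tuple // (tnth_nth None).
have cE (i : 'I_5) : nth 0%N [seq cls (degree e (tgt ((s ^+ i)%g d'))) | i <- iota 0 5] i =
    cls (degree e (tgt ((s ^+ i)%g d'))).
  by rewrite (nth_map 0%N) ?size_iota ?ltn_ord // nth_iota ?ltn_ord.
have winj : injective (fun i : 'I_5 => tgt ((s ^+ i)%g d')).
  move=> i j /= h; have hd : (s ^+ i)%g d' = (s ^+ j)%g d'.
    by apply: dart_inj h; rewrite !(src_sX src_s).
  have [u _] := rot_uniq tr d'; rewrite vE d5' in u.
  apply/val_inj/eqP; rewrite /= -(nth_uniq d' _ _ u) ?size_map ?size_iota //.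
  by rewrite !(nth_map 0%N) ?size_iota ?ltn_ord // !nth_iota ?ltn_ord // hd.
have wadj i : e (src d') (tgt ((s ^+ i)%g d')).
  by have := dartP ((s ^+ i)%g d'); rewrite (src_sX src_s).
have hc := ccw d' 5%N (esym d5').
case/orP: fit => fit.
- exists (src d'), (fun i : 'I_5 => tgt ((s ^+ i)%g d')); split => //; first by left.
  move=> i; apply: bounded_cls (good i) _.
  by rewrite -bE -cE; apply: all2_leq_nth fit _; rewrite size_map size_iota.
(* A fit with the reversed bounds lists the neighbours clockwise, the second alternative of
   [cyclic_order_around]. *)
- exists (src d'), (fun i : 'I_5 => tgt ((s ^+ (rev_ord i))%g d')); split => //.
  + by move=> i j /winj /rev_ord_inj.
  + right; rewrite [X in ccw_around G _ X](_ : _ = fun i : 'I_5 => tgt ((s ^+ i)%g d')) //.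
    by apply/funext => i; rewrite /comp rev_ordK.
  + move=> i; apply: bounded_cls (good i) _; rewrite -bE -(cE (rev_ord i)).
    have := all2_leq_nth (i := rev_ord i) fit; rewrite size_map size_iota => /(_ (ltn_ord _)).
    rewrite nth_rev ?size_map ?size_tuple ?ltn_ord // (_ : 5 - (rev_ord i).+1 = i)%N //=.
    by have := ltn_ord i; lia.
Qed.
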